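(* Let $\mathcal{G}$ be an infinite, locally finite, rooted tree and let $br_r(\mathcal{G})\in[0,\infty]$ be its branching-ruin number. The once-reinforced random walk (ORRW) on $\mathcal{G}$, started at the root, with reinforced parameter $\delta\in(0,\infty)$ is transient if $\delta<br_r(\mathcal{G})$ and recurrent if $\delta>br_r(\mathcal{G})$.
   Context: Let $\mathcal{G}=(V,E)$ be an infinite, locally finite tree with root $\varrho$. For $\nu\in V$, $|\nu|$ is the graph distance from $\varrho$ to $\nu$. Each edge $e$ has endpoints $e^-,e^+$ with $|e^+|=|e^-|+1$, and $|e|:=|e^+|$. A cutset is a set $\pi\subset E$ such that every infinite self-avoiding path $(\nu_i)_{i\ge0}$ with $\nu_0=\varrho$ has a unique $i\ge1$ with $[\nu_{i-1},\nu_i]\in\pi$ (i.e. a minimal set of edges separating the root from infinity); $\Pi$ is the set of cutsets. The branching-ruin number is $$br_r(\mathcal{G})=\sup\Big\{\lambda>0:\ \inf_{\pi\in\Pi}\sum_{e\in\pi}|e|^{-\lambda}>0\Big\},$$ with $\sup\emptyset=0$. The ORRW with parameter $\delta\in(0,\infty)$ is the discrete-time nearest-neighbor process $\mathbf{X}=(X_n)_{n\ge0}$ on $V$ with $X_0=\varrho$ such that, with $E_n=\{e\in E:\exists k\in\{1,\dots,n\},\ \{X_{k-1},X_k\}=\{e^-,e^+\}\}$ the set of edges crossed up to time $n$ and $\mathcal{F}_n=\sigma(X_0,\dots,X_n)$, on $\{X_n=\nu\}$, for each neighbor $\mu$ of $\nu$, $$\mathbf{P}(X_{n+1}=\mu\mid\mathcal{F}_n)=\frac{W_n([\nu,\mu])}{\sum_{\mu'\sim\nu}W_n([\nu,\mu'])},\qquad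 W_n(e)=\begin{cases}\delta,& e\in E_n,\\ 1,& e\notin E_n.\end{cases}$$ Let $T(\varrho)=\inf\{n>0:X_n=\varrho\}$. The walk is recurrent if $\mathbf{P}(T(\varrho)<\infty)=1$ and transient if it is not recurrent, i.e. $\mathbf{P}(T(\varrho)=\infty)>0$. *)

(* Defs.v *)
From HB Require Import structures.
From mathcomp Require Import all_boot all_order all_algebra.
From mathcomp Require Import all_classical all_reals all_analysis.

Set Implicit Arguments.
Unset Strict Implicit.
Unset Printing Implicit Defensive.

Import Order.TTheory GRing.Theory Num.Theory.

Local Open Scope classical_set_scope.
Local Open Scope ring_scope.

(* A graph on V is given by its adjacency relation adj. *)
Record is_tree (V : choiceType) (adj : rel V) : Prop := IsTree {
  tree_sym : symmetric adj;
  tree_irr : irreflexive adj;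
  tree_connected : forall x y : V, exists2 p : seq V, path adj x p & last x p = y;
  tree_acyclic : forall c : seq V, (2 < size c)%N -> ~ ucycle adj c }.

Definition neighbors (V : choiceType) (adj : rel V) (x : V) : set V :=
  [set y | adj x y].

Definition locally_finite (V : choiceType) (adj : rel V) : Prop :=
  forall x : V, finite_set (neighbors adj x).

(* The junk value 0 is only reached when no path joins x to y. *)
Definition graph_dist (V : choiceType) (adj : rel V) (x y : V) : nat :=
  xget 0%N [set n | (exists p, [/\ path adj x p, last x p = y & size p = n]) /\
    forall p, path adj x p -> last x p = y -> (n <= size p)%N].

Definition depth (V : choiceType) (adj : rel V) (root x : V) : nat :=
  graph_dist adj root x.

(* An edge is encoded as the pair (e^-, e^+) of its endpoints, the one closer to
   the root first; so |e| is the depth of its second component. *)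
Definition edges (V : choiceType) (adj : rel V) (root : V) : set (V * V) :=
  [set e | adj e.1 e.2 /\ depth adj root e.2 = (depth adj root e.1).+1].

Definition edge_depth (V : choiceType) (adj : rel V) (root : V) (e : V * V) : nat :=
  depth adj root e.2.

(* {x, y} = {e^-, e^+} *)
Definition joins (V : choiceType) (e : V * V) (x y : V) : Prop :=
  e = (x, y) \/ e = (y, x).

Definition is_ray (V : choiceType) (adj : rel V) (root : V) (nu : nat -> V) : Prop :=
  [/\ nu 0%N = root, (forall i, adj (nu i) (nu i.+1)) & injective nu].

Definition cutsets (V : choiceType) (adj : rel V) (root : V) : set (set (V * V)) :=
  [set pi | pi `<=` edges adj root /\
    forall nu, is_ray adj root nu ->
      exists! i, (1 <= i)%N /\ exists2 e, pi e & joins e (nu i.-1) (nu i)].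

(* A cutset may be infinite (it may contain infinitely many edges lying on no
   infinite self-avoiding path), hence the sum in \bar R. *)
Definition cutset_sum (R : realType) (V : choiceType) (adj : rel V) (root : V)
    (lambda : R) (pi : set (V * V)) : \bar R :=
  \esum_(e in pi) (((edge_depth adj root e)%:R `^ (- lambda))%:E)%E.

(* Adding 0 to the set implements the convention that sup of the empty set is 0;
   it changes nothing otherwise. *)
Definition branching_ruin (R : realType) (V : choiceType) (adj : rel V) (root : V) :
    \bar R :=
  ereal_sup (0%E |` [set lambda%:E | lambda in [set lambda : R | 0 < lambda /\
    (0 < ereal_inf [set cutset_sum adj root lambda pi | pi in cutsets adj root])%E]]).

Section orrw.
Context (R : realType) (V : choiceType) (d : measure_display) (T : measurableType d).
Implicit Types (adj : rel V) (root : V) (X : nat -> T -> V).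

(* E_n *)
Definition crossed adj root X (n : nat) (w : T) : set (V * V) :=
  [set e | edges adj root e /\
    exists k, (1 <= k <= n)%N /\ joins e (X k.-1 w) (X k w)].

(* W_n([x, y]) *)
Definition weight adj root (delta : R) X (n : nat) (w : T) (x y : V) : R :=
  if `[< exists2 e, crossed adj root X n w e & joins e x y >] then delta else 1.

Definition step_prob adj root (delta : R) X (n : nat) (w : T) (x y : V) : R :=
  weight adj root delta X n w x y /
  \sum_(z \in neighbors adj x) weight adj root delta X n w x z.

(* F_n = sigma(X_0, ..., X_n), V carrying the sigma-algebra of all its subsets *)
Definition history X (n : nat) : set (set T) :=
  <<s \bigcup_(k in [set k | (k <= n)%N]) preimage_set_system setT (X k) setT >>.

(* Y is a version of the conditional probability P(B | F). *)
Record is_cond_prob (P : probability T R) (F : set (set T)) (B : set T) (Y : T -> R) :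
    Prop := IsCondProb {
  cond_prob_measurable : forall U : set R, measurable U -> F (Y @^-1` U);
  cond_prob_integrable : P.-integrable setT (EFin \o Y);
  cond_prob_integral : forall A, F A -> (\int[P]_(w in A) (Y w)%:E = P (A `&` B))%E }.

Record is_orrw (P : probability T R) adj root (delta : R) X : Prop := IsORRW {
  orrw_measurable : forall n (B : set V), measurable (X n @^-1` B);
  orrw_start : {ae P, forall w, X 0%N w = root};
  orrw_nearest_neighbor : forall n, {ae P, forall w, adj (X n w) (X n.+1 w)};
  orrw_step : forall n (mu : V), exists2 Y : T -> R,
    is_cond_prob P (history X n) [set w | X n.+1 w = mu] Y &
    {ae P, forall w, adj (X n w) mu ->
      Y w = step_prob adj root delta X n w (X n w) mu} }.

(* T(root), with value +oo when the walk never comes back *)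
Definition return_time root X (w : T) : \bar R :=
  ereal_inf [set (n%:R)%:E | n in [set n : nat | (0 < n)%N /\ X n w = root]].

Definition recurrent (P : probability T R) root X : Prop :=
  P [set w | return_time root X w < +oo]%E = 1%E.

Definition transient (P : probability T R) root X : Prop := ~ recurrent P root X.

End orrw.

(* Main.v *)
(* Write |v| for the depth of v.  In the walk stopped at its return to the root,
   a vertex u with |u| = n is reached with probability at most a constant times
   psi(n), the product of the l / (l + delta) for 0 < l < n, which is of order
   n^-delta: with j the depth of the projection of the walk on the geodesic to u
   and k its running maximum, j / (k psi(k)) is a martingale.

   Recurrence for delta > br_r.  A walk which never returns leaves every ball,
   because 1 - B^|x| with B small is a supermartingale with strict drift inside
   a ball.  It then visits, by Koenig's lemma, all vertices of some ray, hence an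
   endpoint of every cutset pi, which has probability at most a constant times
   the sum over pi of |e|^-delta; and these sums have infimum 0.

   Transience for delta < br_r.  Take lambda in (delta, br_r).  By max-flow
   min-cut there is, for every n, a flow theta from the root to level n, of
   strength bounded below, with theta(v) <= |v|^-lambda.  Let M be the sum over u
   at level n of theta(u) times the martingale of u.  To bound its second moment,
   let u and v separate at depth m; then, with j, k for u and j', k' for v as
   above and a(k) = 1 / (k psi(k)), the expression m (j + j') a(k + m) a(k' + m)
   is again a martingale once the separation point has been visited, and it
   dominates j a(k) j' a(k') up to a constant.  Its initial expectation is of
   order 1 / psi(m), so E[M^2] is at most a constant times the energy of theta,
   that is the sum over u, v of theta(u) theta(v) / psi(m), which is bounded as
   lambda > delta.  By Cauchy-Schwarz the walk avoids the root up to time n with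
   probability bounded below. *)

Require Import Defs.
From mathcomp Require Import all_boot all_order all_algebra.
From mathcomp Require Import all_classical all_reals all_analysis.
From mathcomp Require Import ring lra.

Set Implicit Arguments.
Unset Strict Implicit.
Unset Printing Implicit Defensive.

Import Order.TTheory GRing.Theory Num.Theory.

Local Open Scope classical_set_scope.
Local Open Scope ring_scope.

(** * Hitting probabilities on a half-line *)

Section coefficients.
Context (R : realType).
Implicit Types (delta lambda x : R) (k l m n : nat).

(* [k%:R * coef delta k] is the product of the [1 + delta / l] for [0 < l < k];
   its inverse is the probability that the walk on a half-line reaches [k]
   from [1] before [0]. *)
Fixpoint coef delta k : R :=
  if k is k'.+1 then coef delta k' * (k'%:R + delta) / k'.+1%:R else delta^-1.

Arguments coef : simpl never.

Lemma coefSE delta k :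
  coef delta k.+1 = coef delta k * (k%:R + delta) / k.+1%:R.
Proof. by []. Qed.

Lemma coefS delta k :
  k.+1%:R * coef delta k.+1 = (k%:R + delta) * coef delta k.
Proof. by rewrite coefSE mulrC divfK ?pnatr_eq0 // mulrC. Qed.

Lemma coef1 delta : 0 < delta -> coef delta 1 = 1.
Proof. by move=> d0; rewrite coefSE /coef add0r mulVf ?gt_eqF // divr1. Qed.

Lemma coef_gt0 delta k : 0 < delta -> 0 < coef delta k.
Proof.
move=> d0; elim: k => [|k IH]; first by rewrite invr_gt0.
by rewrite coefSE divr_gt0 ?ltr0n // mulr_gt0 // ltr_wpDl.
Qed.

Lemma coef_mono delta k l : 0 < delta -> (k <= l)%N ->
  k%:R * coef delta k <= l%:R * coef delta l.
Proof.
move=> d0 /subnK <-; elim: (l - k)%N => // n IH.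
rewrite addSn coefS (le_trans IH) // ler_pM2r ?coef_gt0 // lerDl.
exact: ltW.
Qed.

(** For [delta < 1] the sequence [coef] decreases, so the comparison goes through the increasing
    [k%:R * coef delta k]; [k + m <= 2 k] costs the factor 2. *)
Lemma coef_shift delta k m : 0 < delta -> (0 < k)%N -> (m <= k)%N ->
  coef delta k <= 2 * coef delta (k + m).
Proof.
move=> d0 k0 mk; have kR : 0 < k%:R :> R by rewrite ltr0n.
rewrite -(ler_pM2l kR) (le_trans (coef_mono d0 (leq_addr m k))) //.
rewrite mulrA ler_pM2r ?coef_gt0 //.
by rewrite -natrM ler_nat mulnC mul2n -addnn leq_add2l.
Qed.

(** By [coefS], the increments of [k%:R * coef delta k] are [delta * coef delta k]. This later turns
    the weight of a separation depth into a sum over levels. *)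
Lemma coef_sum delta n : 0 < delta ->
  n%:R * coef delta n = \sum_(i < n) delta * coef delta i.
Proof.
move=> d0; elim: n => [|n IH]; first by rewrite mul0r big_ord0.
by rewrite big_ord_recr /= -IH -mulrDl -coefS.
Qed.

Lemma coef_ratio delta k : (0 < k)%N ->
  k.+1%:R * coef delta k.+1 = (1 + delta / k%:R) * (k%:R * coef delta k).
Proof.
move=> k0; rewrite coefS mulrA; congr (_ * _).
by rewrite mulrDl mul1r divfK // pnatr_eq0 -lt0n.
Qed.

(** Both this bound and [powR_succ_ge] are [1 + t <= expR t] raised to the power [delta], with
    [t = 1 / x] here and [t = - 1 / (x + 1)] there. *)
Lemma powR_succ_le delta x : 0 <= delta -> 0 < x ->
  (x + 1) `^ delta <= x `^ delta * expR (delta / x).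
Proof.
move=> d0 x0; have x0' := ltW x0; rewrite [delta / x]mulrC expRM.
rewrite -powRM ?expR_ge0 //.
have xe : x + 1 <= x * expR x^-1.
  rewrite (le_trans _ (ler_wpM2l x0' (expR_ge1Dx _))) //.
  by rewrite mulrDr mulr1 mulfV ?gt_eqF.
by apply: ge0_ler_powR; rewrite // nnegrE ?addr_ge0 // mulr_ge0 ?expR_ge0.
Qed.

Lemma powR_succ_ge delta x : 0 <= delta -> 0 < x ->
  x `^ delta * expR (delta / (x + 1)) <= (x + 1) `^ delta.
Proof.
move=> d0 x0; have x1 : 0 < x + 1 by rewrite addr_gt0.
have x0' := ltW x0; have x1' := ltW x1.
rewrite -ler_pdivlMr ?expR_gt0 // -expRN -mulrN -invrN [delta / _]mulrC.
rewrite expRM -powRM ?expR_ge0 //.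
have xe : x <= (x + 1) * expR (- (x + 1))^-1.
  rewrite (le_trans _ (ler_wpM2l x1' (expR_ge1Dx _))) // mulrDr mulr1 invrN mulrN.
  by rewrite mulfV ?gt_eqF // addrK.
by apply: ge0_ler_powR; rewrite // nnegrE ?mulr_ge0 ?expR_ge0.
Qed.

Lemma coef_upper delta n : 0 < delta ->
  n.+1%:R * coef delta n.+1 <= (1 + delta) * n.+1%:R `^ delta.
Proof.
move=> d0; have d0' := ltW d0; have d1 : 0 < 1 + delta by rewrite addr_gt0.
case: n => [|n]; first by rewrite coef1 // mul1r powR1 mulr1 lerDl.
(* The induction runs with the power lagging one index behind: the new factor [1 + delta / (n + 2)]
   is at most [expR (delta / (n + 2))], which [powR_succ_ge] at [x = n + 1] absorbs. *)
suff h : n.+2%:R * coef delta n.+2 <= (1 + delta) * n.+1%:R `^ delta.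
  rewrite (le_trans h) // ler_pM2l //.
  by apply: ge0_ler_powR; rewrite ?nnegrE ?ler_nat ?ler0n.
elim: n => [|n IH]; first by rewrite coefS coef1 // powR1 !mulr1.
have n1 : 0 < n.+1%:R :> R by rewrite ltr0n.
rewrite coef_ratio // (le_trans (ler_wpM2l _ IH)) ?addr_ge0 ?divr_ge0 //.
rewrite mulrCA ler_pM2l // -[n.+2%:R]natr1.
rewrite (le_trans _ (powR_succ_ge d0' n1)) // mulrC ler_wpM2l ?powR_ge0 //.
exact: expR_ge1Dx.
Qed.

Lemma coef_lower delta n : 0 < delta ->
  n.+1%:R `^ delta <= (1 + delta) `^ delta * (n.+1%:R * coef delta n.+1).
Proof.
move=> d0; have d0' := ltW d0.
(* The shift of the base by [delta] closes the induction: with [t = delta / (n + 1 + delta)], the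
   left side grows by a factor at most [expR t <= 1 / (1 - t) = 1 + delta / (n + 1)], which is the
   ratio in [coef_ratio]. *)
suff h : (n.+1%:R + delta) `^ delta <= (1 + delta) `^ delta * (n.+1%:R * coef delta n.+1).
  rewrite (le_trans _ h) //; apply: ge0_ler_powR; rewrite ?nnegrE ?lerDl //.
  by rewrite addr_ge0.
elim: n => [|n IH]; first by rewrite coef1 // !mulr1.
have n1 : 0 < n.+1%:R :> R by rewrite ltr0n.
have nd : 0 < n.+1%:R + delta by rewrite addr_gt0.
rewrite -natr1 addrAC (le_trans (powR_succ_le d0' nd)) //.
rewrite natr1 coef_ratio // mulrCA mulrC.
apply: ler_pM; rewrite ?expR_ge0 ?powR_ge0 //.
have t0 : 0 < 1 - delta / (n.+1%:R + delta).
  by rewrite subr_gt0 ltr_pdivrMr // mul1r ltrDr.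
have := expR_ge1Dx (- (delta / (n.+1%:R + delta))).
rewrite expRN -lef_pV2 ?posrE ?invr_gt0 ?expR_gt0 // invrK => h.
rewrite (le_trans h) // le_eqVlt; apply/orP; left; apply/eqP.
have -> : 1 - delta / (n.+1%:R + delta) = n.+1%:R / (n.+1%:R + delta).
  by rewrite -[X in X - _](mulfV (lt0r_neq0 nd)) -mulrBl addrK.
by rewrite invf_div mulrDl mulfV // gt_eqF.
Qed.

Lemma coef_gt0S delta n : 0 < delta -> 0 < n.+1%:R * coef delta n.+1.
Proof. by move=> d0; rewrite mulr_gt0 ?coef_gt0. Qed.

(* The terms are dominated by the increments of [coef delta i / coef lambda i],
   which decreases because [delta < lambda]. *)
Lemma coef_energy delta lambda n : 0 < delta -> delta < lambda ->
  \sum_(i < n) coef delta i.+1 * i.+1%:R `^ (- lambda)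
    <= (1 + lambda) ^+ 2 / (lambda - delta).
Proof.
move=> d0 dl; have l0 := lt_trans d0 dl; have ld : 0 < lambda - delta by rewrite subr_gt0.
pose t i := coef delta i.+1 / coef lambda i.+1.
(* The decrement of [t] at [n] is [t n * (lambda - delta) / (n + 1 + lambda)]. One factor
   [1 + lambda] comes from [coef_upper], the other from
   [n + 1 + lambda <= (1 + lambda) * (n + 1)]. *)
pose K := (1 + lambda) ^+ 2 / (lambda - delta).
have K0 : 0 < K by rewrite divr_gt0 // exprn_gt0 // addr_gt0.
have t_gt0 i : 0 < t i by rewrite divr_gt0 ?coef_gt0.
have tS i : t i.+1 = t i * ((i.+1%:R + delta) / (i.+1%:R + lambda)).
  have h1 : 0 < i.+1%:R + lambda by rewrite addr_gt0.
  have h2 : 0 < i.+2%:R :> R by rewrite ltr0n.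
  rewrite /t !(coefSE _ i.+1).
  have := coef_gt0 i.+1 l0; move: (coef lambda i.+1) (coef delta i.+1) h1 h2.
  move: (i.+2%:R : R) (i.+1%:R : R) => z w x y h1 h2 x0.
  by field; rewrite !gt_eqF.
suff h : \sum_(i < n) coef delta i.+1 * i.+1%:R `^ (- lambda) <= K * (t 0%N - t n).
  rewrite (le_trans h) // -[leRHS]mulr1 ler_wpM2l ?(ltW K0) //.
  by rewrite {1}/t !coef1 // divr1 lerBlDr lerDl ltW.
elim: n => [|n IH]; first by rewrite big_ord0 subrr mulr0.
rewrite big_ord_recr /=.
suff : coef delta n.+1 * n.+1%:R `^ (- lambda) <= K * (t n - t n.+1) by lra.
have n1 : 0 < n.+1%:R :> R by rewrite ltr0n.
have p0 : 0 < n.+1%:R `^ lambda by rewrite powR_gt0.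
have c0 := coef_gt0 n.+1 l0; have c1 := coef_gt0 n.+1 d0.
have up : n.+1%:R `^ (- lambda) <= (1 + lambda) / (n.+1%:R * coef lambda n.+1).
  rewrite powRN ler_pdivlMr ?coef_gt0S // mulrC ler_pdivrMr //.
  exact: coef_upper.
rewrite (le_trans (ler_wpM2l (ltW c1) up)) //.
have -> : K * (t n - t n.+1) = (1 + lambda) ^+ 2 * t n / (n.+1%:R + lambda).
  by rewrite tS /K; field; rewrite !gt_eqF // addr_gt0.
have -> : coef delta n.+1 * ((1 + lambda) / (n.+1%:R * coef lambda n.+1)) =
          (1 + lambda) * t n / n.+1%:R.
  by rewrite /t; field; rewrite !gt_eqF.
rewrite ler_pdivrMr // [leRHS]mulrAC ler_pdivlMr ?addr_gt0 //.
move: (t n) (t_gt0 n) => u u0.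
rewrite expr2 -!mulrA ler_pM2l ?addr_gt0 // [leRHS]mulrCA ler_pM2l //.
by rewrite mulrDl mul1r lerD2l ler_peMr ?ler1n // ltW.
Qed.

End coefficients.

Arguments coef : simpl never.
(** * Rooted trees *)

Section tree.
Context (V : choiceType) (adj : rel V) (root : V).
Hypothesis tree_adj : is_tree adj.
Local Notation dep := (depth adj root).

Let adjC : symmetric adj := tree_sym tree_adj.

(** Connectedness makes the set of path lengths nonempty, so the minimum exists and the default
    value of [graph_dist] is never taken. *)
Lemma depthP x :
  (exists p, [/\ path adj root p, last root p = x & size p = dep x]) /\
  forall p, path adj root p -> last root p = x -> (dep x <= size p)%N.
Proof.
rewrite /depth /graph_dist; set A := [set n | _].
suff : A (xget 0%N A) by [].
apply: xgetPex.
have [p px pl] := tree_connected tree_adj root x.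
pose Q (n : nat) := `[< exists p, [/\ path adj root p, last root p = x & size p = n] >].
have exQ : exists n, Q n by exists (size p); apply/asboolP; exists p.
case: (ex_minnP exQ) => n /asboolP[r [rx rl rs]] nmin.
exists n; split; first by exists r.
by move=> r' r'x r'l; apply: nmin; apply/asboolP; exists r'.
Qed.

Lemma depth_root : dep root = 0%N.
Proof.
by apply/eqP; rewrite -leqn0; have [_ /(_ [::])] := depthP root; apply.
Qed.

Lemma depth_eq0 x : (dep x == 0%N) = (x == root).
Proof.
apply/eqP/eqP => [d0|->]; last exact: depth_root.
have [[p [_ px ps]] _] := depthP x; move: ps px; rewrite d0.
by case: p.
Qed.

Lemma depth_adj x y : adj x y -> (dep y <= (dep x).+1)%N.
Proof.
move=> xy; have [[p [px pl <-]] _] := depthP x.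
have [_ /(_ (rcons p y))] := depthP y.
rewrite size_rcons; apply; last by rewrite last_rcons.
by rewrite rcons_path px pl.
Qed.

Lemma depth_pred x n : dep x = n.+1 -> exists2 y, adj x y & dep y = n.
Proof.
move=> xn; have [[p [px pl ps]] _] := depthP x.
case/lastP: p px pl ps => [|p z]; first by rewrite xn.
rewrite rcons_path last_rcons size_rcons xn => /andP[px az] zx [ps].
rewrite zx in az; exists (last root p); first by rewrite adjC.
apply/eqP; rewrite eqn_leq -{1}ps; have [_ ->] //= := depthP (last root p).
by rewrite -ltnS -xn depth_adj.
Qed.

Lemma geodesic_to_root y :
  exists p, [/\ path adj y p, last y p = root &
             forall z, z \in p -> (dep z < dep y)%N].
Proof.
move: {2}(dep y) (erefl (dep y)) => n; elim: n y => [|n IH] y yn.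
  by exists [::]; split=> //; apply/eqP; rewrite -depth_eq0 yn.
have [z yz zn] := depth_pred yn; have [p [pz pl pd]] := IH z zn.
exists (z :: p); split=> //=; first by rewrite yz.
move=> u; rewrite inE => /predU1P[->|/pd up]; first by rewrite zn yn.
by rewrite (ltn_trans up) // zn yn.
Qed.

(* A path joining two distinct neighbours of [x] and avoiding [x] would close
   up to a simple cycle through [x]. *)
Lemma neighbors_separated x y z p : adj x y -> adj x z -> path adj y p ->
  last y p = z -> x \notin y :: p -> y = z.
Proof.
move=> xy xz py pz xp; apply: contrapT => yz.
case: (shortenP py) pz => q qy uq sq qz.
have qn : (0 < size q)%N by case: q {qy uq sq} qz.
apply: (tree_acyclic tree_adj (c := x :: y :: q)) => //.
rewrite /ucycle; apply/andP; split.
  by rewrite /= xy rcons_path qy qz adjC xz.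
rewrite cons_uniq uq andbT; apply: contra xp; rewrite !inE.
by move=> /orP[->//|/sq ->]; rewrite orbT.
Qed.

(** Descending paths from [y] and from [z], glued at the root, join [y] to [z]. The last two
    hypotheses keep them away from [x], so [neighbors_separated] applies. *)
Lemma neighbors_join x y z : adj x y -> adj x z ->
  (forall p, last y p = root -> (forall u, u \in p -> (dep u < dep y)%N) ->
     x \notin y :: p) ->
  (forall p, (forall u, u \in p -> (dep u < dep z)%N) -> x \notin z :: p) ->
  y = z.
Proof.
move=> xy xz hy hz.
have [p [py pr pd]] := geodesic_to_root y.
have [q [qz qr qd]] := geodesic_to_root z.
have {hy} xp := hy p pr pd; have {hz} xq := hz q qd.
apply: (@neighbors_separated x y z (p ++ rev (belast z q))) => //.
- rewrite cat_path py pr -qr /=.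
  rewrite -(eq_path (e := fun u v => adj v u)); last by move=> ? ?; rewrite adjC.
  by rewrite rev_path.
- rewrite last_cat pr -qr; case: q {qz qr qd xq} => //= u q.
  by rewrite rev_cons last_rcons.
- rewrite -cat_cons mem_cat negb_or xp mem_rev.
  by apply: contra xq => /mem_belast.
Qed.

(** If the depths agreed, [y] and a neighbour of [x] one level higher would both have descending
    paths to the root avoiding [x], hence would coincide. *)
Lemma depth_adj_neq x y : adj x y -> dep x <> dep y.
Proof.
move=> xy dxy.
have nxy : x != y by apply: contraTneq xy => ->; rewrite (tree_irr tree_adj).
case dx: (dep x) => [|n].
  have /eqP xr : x == root by rewrite -depth_eq0 dx.
  have /eqP yr : y == root by rewrite -depth_eq0 -dxy dx.
  by rewrite xr yr eqxx in nxy.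
have [z xz zn] := depth_pred dx.
suff yz : y = z by move: dxy; rewrite yz zn dx => /esym/n_Sn.
apply: (neighbors_join xy xz) => [p _ pd|p pd].
  rewrite inE negb_or nxy; apply/negP => /pd.
  by rewrite dxy ltnn.
rewrite inE negb_or; apply/andP; split.
  by apply/eqP => xzE; move: dx; rewrite xzE zn => /n_Sn.
by apply/negP => /pd; rewrite zn dx ltnNge leqnSn.
Qed.

Lemma parent_unique x y z : adj x y -> adj x z ->
  dep x = (dep y).+1 -> dep x = (dep z).+1 -> y = z.
Proof.
suff key u : dep x = (dep u).+1 ->
    forall p, (forall v, v \in p -> (dep v < dep u)%N) -> x \notin u :: p.
  move=> xy xz dy dz; apply: (neighbors_join xy xz) => [p _|]; exact: key.
move=> du p pd; rewrite inE negb_or; apply/andP; split.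
  by apply/eqP => xu; move: du; rewrite -xu; exact: n_Sn.
by apply/negP => /pd; rewrite du ltnNge leqnSn.
Qed.

(** At the root the set is empty and the default value makes the root its own parent. *)
Definition parent x : V := xget x [set y | adj x y /\ dep x = (dep y).+1].
Local Notation par := parent.

Lemma parentP x : x != root -> adj x (par x) /\ dep x = (dep (par x)).+1.
Proof.
rewrite -depth_eq0; case dx: (dep x) => [//|n] _.
suff : [set y | adj x y /\ dep x = (dep y).+1] (par x).
  by rewrite /= dx.
by apply: xgetPex; have [y xy yn] := depth_pred dx; exists y; rewrite /= dx yn.
Qed.

Lemma depth_parent x : x != root -> dep x = (dep (par x)).+1.
Proof. by move=> /parentP[]. Qed.

Lemma parent_adj x : x != root -> adj x (par x).
Proof. by move=> /parentP[]. Qed.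

Lemma parent_eq x y : adj x y -> dep x = (dep y).+1 -> par x = y.
Proof.
move=> xy dxy; have x0 : x != root by rewrite -depth_eq0 dxy.
have [xp dp] := parentP x0; exact: parent_unique dp dxy.
Qed.

Lemma adj_cases x y : adj x y ->
  (x != root /\ y = par x) \/ (y != root /\ x = par y).
Proof.
move=> xy; have := depth_adj xy; rewrite leq_eqVlt => /orP[/eqP dy|].
  right; split; first by rewrite -depth_eq0 dy.
  by apply/esym/parent_eq; rewrite // adjC.
rewrite ltnS leq_eqVlt => /orP[/eqP /esym/(depth_adj_neq xy)//|yx].
left; split; first by rewrite -depth_eq0 -lt0n (leq_ltn_trans _ yx).
apply/esym/parent_eq => //; apply/eqP; rewrite eqn_leq yx andbT.
by rewrite depth_adj // adjC.
Qed.

(* The vertices other than the root on the geodesic from [x] to the root. *)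
Definition line x : seq V := traject par x (dep x).

Lemma line_root : line root = [::].
Proof. by rewrite /line depth_root. Qed.

Lemma lineE x : x != root -> line x = x :: line (par x).
Proof. by move=> x0; rewrite /line depth_parent. Qed.

Lemma size_line x : size (line x) = dep x.
Proof. exact: size_traject. Qed.

Lemma line_ind (Q : V -> Prop) :
  Q root -> (forall x, x != root -> Q (par x) -> Q x) -> forall x, Q x.
Proof.
move=> Q0 QS x; move: {2}(dep x) (erefl (dep x)) => n; elim: n x => [|n IH] x dx.
  by have /eqP -> : x == root by rewrite -depth_eq0 dx.
have x0 : x != root by rewrite -depth_eq0 dx.
by apply: QS => //; apply: IH; have := depth_parent x0; rewrite dx => -[].
Qed.

Lemma mem_line_neq x u : u \in line x -> u != root.
Proof.
elim/line_ind: x => [|x x0 IH]; first by rewrite line_root.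
by rewrite lineE // inE => /predU1P[->|].
Qed.

Lemma line_mem x : x != root -> x \in line x.
Proof. by move=> x0; rewrite lineE // mem_head. Qed.

Lemma mem_line_depth x u : u \in line x -> (0 < dep u <= dep x)%N.
Proof.
move=> ux; rewrite lt0n depth_eq0 (mem_line_neq ux) /=; move: ux.
elim/line_ind: x => [|x x0 IH]; first by rewrite line_root.
rewrite lineE // inE => /predU1P[->//|/IH h].
by rewrite (leq_trans h) // (depth_parent x0).
Qed.

Lemma line_sub x u : u \in line x -> {subset line u <= line x}.
Proof.
elim/line_ind: x => [|x x0 IH]; first by rewrite line_root.
rewrite [in u \in _]lineE // inE => /predU1P[->//|ux] v vu.
by rewrite lineE // inE IH ?orbT.
Qed.

Lemma line_uniq x : uniq (line x).
Proof.
elim/line_ind: x => [|x x0 IH]; first by rewrite line_root.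
rewrite lineE //= IH andbT; apply/negP => /mem_line_depth.
by rewrite (depth_parent x0) ltnn andbF.
Qed.

Lemma mem_line_eq x u : u \in line x -> (dep x <= dep u)%N -> u = x.
Proof.
case: (eqVneq x root) => [->|x0]; first by rewrite line_root.
rewrite lineE // inE => /predU1P[->//|/mem_line_depth/andP[_]].
by rewrite (depth_parent x0) => h1 h2; move: (leq_trans h2 h1); rewrite ltnn.
Qed.

Lemma line_inj x u v : u \in line x -> v \in line x -> dep u = dep v -> u = v.
Proof.
elim/line_ind: x => [|x x0 IH]; first by rewrite line_root.
move=> ux vx duv; move: (ux) (vx); rewrite lineE // !inE.
move=> /predU1P[ux'|ux'] /predU1P[vx'|vx']; last exact: IH.
- by rewrite ux'.
- by rewrite ux'; apply/esym/(mem_line_eq vx); rewrite -duv ux'.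
- by rewrite vx'; apply: (mem_line_eq ux); rewrite duv vx'.
Qed.

Lemma line_comparable x u z : u \in line x -> z \in line x ->
  (dep z <= dep u)%N -> z \in line u.
Proof.
elim/line_ind: x => [|x x0 IH].
  by rewrite line_root.
move=> ux zx zu; have [xu|] := leqP (dep x) (dep u).
  by rewrite (mem_line_eq ux xu).
move=> ux'; apply: IH => //.
  move: ux; rewrite lineE // inE => /predU1P[uE|//].
  by rewrite uE ltnn in ux'.
move: zx; rewrite lineE // inE => /predU1P[zE|//].
by move: (leq_ltn_trans zu ux'); rewrite zE ltnn.
Qed.

Lemma mem_line_parent x y : y != root -> y \in line x -> par y != root ->
  par y \in line x.
Proof.
move=> y0 yx p0; apply: (line_sub yx); rewrite lineE // inE.
by rewrite line_mem ?orbT.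
Qed.

Lemma line_child u x : x \in root :: line u -> (dep x < dep u)%N ->
  exists y, [/\ y \in line u, y != root & par y = x].
Proof.
elim/line_ind: u => [|u u0 IH].
  by rewrite depth_root.
move=> xu xltu; have [xp|xp] := eqVneq x (par u).
  by exists u; rewrite xp line_mem.
have xpu : x \in root :: line (par u).
  move: xu; rewrite lineE // !inE => /or3P[->//|/eqP xE|->]; last by rewrite orbT.
  by rewrite xE ltnn in xltu.
have [|y [yu y0 py]] := IH xpu.
  rewrite ltn_neqAle -ltnS -(depth_parent u0) xltu andbT.
  apply: contra xp => /eqP dxp; move: xpu; rewrite inE => /predU1P[xr|xl].
    by rewrite xr eq_sym -depth_eq0 -dxp xr depth_root.
  by rewrite (mem_line_eq xl) // dxp.
by exists y; split=> //; rewrite lineE // inE yu orbT.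
Qed.

(* The depth of the point where the geodesics from the root to [u] and to [x]
   separate. *)
Definition meet u x := count (mem (line u)) (line x).

Lemma meet_root u : meet u root = 0%N.
Proof. by rewrite /meet line_root. Qed.

Lemma meet_in u x : x \in line u -> meet u x = dep x.
Proof.
move=> xu; rewrite /meet -[RHS]size_line.
by apply/eqP; rewrite -all_count; apply/allP; exact: line_sub.
Qed.

Lemma meet_out u x : x != root -> x \notin line u -> meet u x = meet u (par x).
Proof. by move=> x0 xu; rewrite /meet (lineE x0) /= (negPf xu). Qed.

Lemma meetC u v : meet u v = meet v u.
Proof.
rewrite /meet -!size_filter; apply/perm_size/uniq_perm.
- by rewrite filter_uniq // line_uniq.
- by rewrite filter_uniq // line_uniq.
- by move=> z; rewrite !mem_filter andbC.
Qed.

Lemma meet_le u v : (meet u v <= dep v)%N.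
Proof. by rewrite -[leqRHS]size_line count_size. Qed.

(** [line u] has left [line v] before [x], so cutting off its part beyond [x] removes no vertex of
    [line v]. *)
Lemma meet_branch u v x : x \in line u -> x \notin line v -> meet v x = meet v u.
Proof.
elim/line_ind: u => [|u u0 IH].
  by rewrite line_root.
move=> xu xv; have uv : u \notin line v.
  by apply: contra xv => uv; exact: (line_sub uv).
move: (xu); rewrite lineE // inE => /predU1P[->//|xpu].
by rewrite (meet_out u0 uv) IH.
Qed.

Lemma meet_both u v x : x \in line u -> x \in line v -> (dep x <= meet u v)%N.
Proof.
move=> xu xv; rewrite -[leqLHS]size_line /meet -size_filter.
apply: uniq_leq_size; first exact: line_uniq.
by move=> z zx; rewrite mem_filter /= !(line_sub _ zx).
Qed.

Lemma meet_lt u v x : x \in line u -> x \notin line v -> (meet u v < dep x)%N.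
Proof.
move=> xu xv; have x0 := mem_line_neq xu.
rewrite meetC -(meet_branch xu xv) meet_out // (depth_parent x0) ltnS.
exact: meet_le.
Qed.

Lemma meet_child u v y : y \in line u -> (dep y <= meet u v)%N -> y \in line v.
Proof.
move=> yu; apply: contraTT => yv.
by rewrite -ltnNge meet_lt.
Qed.

(** The vertices visited by a nearest-neighbour walk from the root form such a set, because a vertex
    is first entered from its parent. *)
Definition history_closed (H : seq V) : Prop :=
  root \in H /\ forall y, y \in H -> y != root -> par y \in H.

Lemma history_line H y : history_closed H -> y \in H -> {subset line y <= H}.
Proof.
move=> [rH cH]; elim/line_ind: y => [|y y0 IH].
  by rewrite line_root.
move=> yH z; rewrite lineE // inE => /predU1P[->//|]; apply: IH.
exact: cH.
Qed.

(* When [H] is closed under taking parents, the depth of its deepest vertex on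
   the geodesic to [u]. *)
Definition seen u (H : seq V) := count (mem H) (line u).

Lemma seen_in u y H : y \in H -> seen u (y :: H) = seen u H.
Proof.
by move=> yH; apply: eq_count => z /=; rewrite inE; case: eqP => // ->.
Qed.

Lemma seen_out u y H : y \notin line u -> seen u (y :: H) = seen u H.
Proof.
move=> yu; apply: eq_in_count => z zu /=; rewrite inE.
by case: eqP => // zy; rewrite -zy zu in yu.
Qed.

(** Since [H] is closed under parents, its trace on [line u] is an initial segment starting next to
    the root; counting it gives the depth of its last vertex. *)
Lemma seenE u y H : history_closed H -> y \in line u ->
  (dep y <= seen u H)%N = (y \in H).
Proof.
move=> cH yu; apply/idP/idP => [|yH]; last first.
  rewrite -[leqLHS]size_line /seen -size_filter.
  apply: uniq_leq_size => [|z zy]; first exact: line_uniq.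
  by rewrite mem_filter /= (history_line cH yH zy) (line_sub yu zy).
apply: contraTT => yH; have y0 := mem_line_neq yu.
rewrite -ltnNge (depth_parent y0) ltnS.
rewrite -(size_line (par y)) /seen -size_filter.
apply: uniq_leq_size => [|z]; first by rewrite filter_uniq // line_uniq.
rewrite mem_filter /= => /andP[zH zu].
have zy : (dep z < dep y)%N.
  rewrite ltnNge; apply: contra yH => yz.
  exact: (history_line cH zH (line_comparable zu yu yz)).
have := line_comparable yu zu (ltnW zy); rewrite lineE // inE => /predU1P[zE|//].
by rewrite zE ltnn in zy.
Qed.

Lemma seen_tip u y H : history_closed H -> y \in line u -> par y \in H ->
  y \notin H -> seen u H = dep (par y).
Proof.
move=> cH yu pH yH; have y0 := mem_line_neq yu.
apply/eqP; rewrite eqn_leq -ltnS -(depth_parent y0).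
rewrite ltnNge (seenE cH yu) yH /=.
have [->|p0] := eqVneq (par y) root; first by rewrite depth_root.
by rewrite seenE // mem_line_parent.
Qed.

Lemma seen_cons_tip u y H : history_closed H -> y \in line u -> par y \in H ->
  y \notin H -> seen u (y :: H) = dep y.
Proof.
move=> cH yu pH yH; have y0 := mem_line_neq yu.
have cyH : history_closed (y :: H).
  case: cH => rH cH; split; first by rewrite inE rH orbT.
  move=> z; rewrite inE => /predU1P[->|zH] z0; first by rewrite inE pH orbT.
  by rewrite inE cH ?orbT.
apply/eqP; rewrite eqn_leq (seenE cyH yu) mem_head andbT.
rewrite -(size_line y) /seen -size_filter.
apply: uniq_leq_size => [|z]; first by rewrite filter_uniq // line_uniq.
rewrite mem_filter /= inE => /andP[/predU1P[->|zH] zu]; first exact: line_mem.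
apply: (line_comparable yu zu); rewrite ltnW // ltnNge.
apply: contra yH => yz.
exact: (history_line cH zH (line_comparable zu yu yz)).
Qed.

Lemma meet_le_seen u x H : history_closed H -> x \in H -> (meet u x <= seen u H)%N.
Proof.
move=> cH xH; rewrite meetC /meet /seen.
by apply: sub_count => z /(history_line cH xH).
Qed.

Lemma seen_le u H : (seen u H <= dep u)%N.
Proof. by rewrite -[leqRHS]size_line count_size. Qed.

(** * Neighbours and children in a locally finite tree *)

Hypothesis locfin_adj : locally_finite adj.

Definition nbs x : seq V := finmap.enum_fset (fset_set (neighbors adj x)).

Lemma mem_nbs x y : (y \in nbs x) = adj x y.
Proof.
rewrite /nbs; apply/idP/idP => [|xy].
  by rewrite in_fset_set ?inE //; exact: locfin_adj.
by rewrite in_fset_set ?inE //; exact: locfin_adj.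
Qed.

Lemma nbs_uniq x : uniq (nbs x).
Proof. exact: finmap.fset_uniq. Qed.

Definition children x : seq V := [seq y <- nbs x | (y != root) && (par y == x)].

Lemma mem_children x y : (y \in children x) = (y != root) && (par y == x).
Proof.
rewrite mem_filter mem_nbs andb_idr // => /andP[y0 /eqP <-].
by rewrite adjC parent_adj.
Qed.

Lemma children_uniq x : uniq (children x).
Proof. by rewrite filter_uniq // nbs_uniq. Qed.

Lemma parent_notin_children x : x != root -> par x \notin children x.
Proof.
move=> x0; rewrite mem_children negb_and negbK.
have [//|p0] := eqVneq (par x) root; apply/eqP => px.
have := depth_parent x0; rewrite (depth_parent p0) px.
by move/eqP; rewrite -[X in X == _]addn0 -addn2 eqn_add2l.
Qed.

Lemma perm_nbs x : x != root -> perm_eq (nbs x) (par x :: children x).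
Proof.
move=> x0; apply: uniq_perm; first exact: nbs_uniq.
  by rewrite /= parent_notin_children // children_uniq.
move=> y; rewrite mem_nbs inE mem_children; apply/idP/idP.
  by move=> /adj_cases[[_ ->]|[y0 ->]]; rewrite ?eqxx ?y0 ?orbT.
by move=> /predU1P[->|/andP[y0 /eqP <-]]; rewrite ?parent_adj // adjC parent_adj.
Qed.

Lemma nbs_root : perm_eq (nbs root) (children root).
Proof.
apply: uniq_perm; [exact: nbs_uniq|exact: children_uniq|].
move=> y; rewrite mem_nbs mem_children; apply/idP/idP.
  by move=> /adj_cases[[]|[y0 <-]]; rewrite ?eqxx // y0.
by move=> /andP[y0 /eqP <-]; rewrite adjC parent_adj.
Qed.

Lemma depth_children x y : y \in children x -> dep y = (dep x).+1.
Proof. by rewrite mem_children => /andP[/depth_parent -> /eqP ->]. Qed.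

Lemma line_child_unique u x y z : y \in children x -> z \in children x ->
  y \in line u -> z \in line u -> y = z.
Proof.
move=> yx zx yu zu; apply: (line_inj yu zu).
by rewrite (depth_children yx) (depth_children zx).
Qed.

Section neighbor_sums.
Context (R : realType) (G : V -> R).

(** With [sum_nbs1] and [sum_nbs2], this reduces a one-step balance to the parent and to those
    children, at most two, that lie on the geodesics under study. *)
Lemma sum_nbs0 x : x != root -> (forall y, y \in children x -> G y = 0) ->
  \sum_(y <- nbs x) G y = G (par x).
Proof.
move=> x0 G0; rewrite (perm_big _ (perm_nbs x0)) big_cons /=.
by rewrite big_seq big1 ?addr0 // => y /G0.
Qed.

Lemma sum_children1 x z : z \in children x ->
  (forall y, y \in children x -> y != z -> G y = 0) ->
  \sum_(y <- children x) G y = G z.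
Proof.
move=> zx G0; rewrite (bigD1_seq z) ?children_uniq //= big_seq_cond big1 ?addr0 //.
by move=> y /andP[yx yz]; exact: G0.
Qed.

Lemma sum_nbs1 x z : x != root -> z \in children x ->
  (forall y, y \in children x -> y != z -> G y = 0) ->
  \sum_(y <- nbs x) G y = G (par x) + G z.
Proof.
move=> x0 zx G0; rewrite (perm_big _ (perm_nbs x0)) big_cons.
by rewrite (sum_children1 zx).
Qed.

Lemma sum_nbs2 x z z' : x != root -> z \in children x -> z' \in children x ->
  z != z' -> (forall y, y \in children x -> y != z -> y != z' -> G y = 0) ->
  \sum_(y <- nbs x) G y = G (par x) + G z + G z'.
Proof.
move=> x0 zx z'x zz' G0; rewrite (perm_big _ (perm_nbs x0)) big_cons -addrA.
congr (_ + _); rewrite (bigD1_seq z) ?children_uniq //=; congr (_ + _).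
rewrite -big_filter (bigD1_seq z') /=; last 2 first.
- by rewrite mem_filter eq_sym zz'.
- by rewrite filter_uniq // children_uniq.
rewrite big_seq_cond big1 ?addr0 // => y /andP[].
by rewrite mem_filter => /andP[yz yx] yz'; exact: G0.
Qed.

End neighbor_sums.

(** * Harmonic functions of the reinforced walk *)

Section harmonic.
Context (R : realType) (delta : R).
Hypothesis delta_gt0 : 0 < delta.
Local Notation coef := (coef delta).

(** In a tree, an edge at the current vertex has been crossed exactly when its other endpoint has
    been visited, so the visited vertices determine the weights; [weight_traj] proves this for the
    walk. *)
Definition reinforced (H : seq V) y : R := if y \in H then delta else 1.

Lemma seen_mono u y H : (seen u H <= seen u (y :: H))%N.
Proof. by apply: sub_count => z zH /=; rewrite inE [z \in H]zH orbT. Qed.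

Lemma meet_parent u x : x \in line u -> (meet u (par x)).+1 = dep x.
Proof.
move=> xu; have x0 := mem_line_neq xu; rewrite (depth_parent x0); congr _.+1.
have [->|p0] := eqVneq (par x) root; first by rewrite meet_root depth_root.
by rewrite meet_in // mem_line_parent.
Qed.

(* One-step balance at a vertex of the geodesic to [u], whether or not the next
   vertex [z] of this geodesic is new; [s] is an arbitrary shift of the depths. *)
Lemma child_advance u x z H s : history_closed H -> x \in H -> x \in line u ->
  z \in children x -> z \in line u ->
  reinforced H z * ((dep x + s).+1%:R * coef (seen u (z :: H) + s)
                    - (dep x + s)%:R * coef (seen u H + s))
    = delta * coef (seen u H + s).
Proof.
move=> cH xH xu zx zu; have := zx; rewrite mem_children => /andP[z0 /eqP pz].
rewrite /reinforced; case: ifP => zH.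
  by rewrite seen_in // -mulrBl -natr1 addrAC subrr add0r mul1r.
rewrite mul1r (seen_tip cH zu) ?pz ?zH // (seen_cons_tip cH zu) ?pz ?zH //.
by rewrite (depth_children zx) addSn coefS mulrDl addrAC subrr add0r.
Qed.

Lemma children_line u x y : x != root -> y \in children x -> y \in line u ->
  x \in line u.
Proof.
move=> x0; rewrite mem_children => /andP[y0 /eqP py] yu.
by rewrite -py mem_line_parent // py.
Qed.

Lemma line_child_in u x : x \in line u -> (dep x < dep u)%N ->
  exists2 z, z \in children x & z \in line u.
Proof.
move=> xu xltu; have [|z [zu z0 zp]] := @line_child u x _ xltu.
  by rewrite inE xu orbT.
by exists z; rewrite // mem_children z0 zp eqxx.
Qed.

(* Once divided by [(dep u)%:R * coef (dep u)], the probability to visit [u]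
   before the root, if the walk cannot escape to infinity elsewhere. *)
Definition hitting u (H : seq V) : R :=
  if (dep u <= seen u H)%N then (dep u)%:R * coef (dep u)
  else (meet u (head root H))%:R * coef (seen u H).

(** Off [line u] no move changes the value. On it, only two moves do: the parent contributes
    [- delta * coef (seen u H')] and the next vertex of the line the opposite, by [child_advance]
    without shift. *)
Lemma hitting_harmonic u x H : history_closed (x :: H) -> x != root ->
  \sum_(y <- nbs x) reinforced (x :: H) y *
    (hitting u (y :: x :: H) - hitting u (x :: H)) = 0.
Proof.
move=> cH x0; set H' := x :: H in cH *; have xH : x \in H' by exact: mem_head.
have pH : par x \in H' by apply: (cH.2 x).
have [uk|ku] := leqP (dep u) (seen u H').
  rewrite big1 // => y _; rewrite /hitting uk (leq_trans uk (seen_mono _ _ _)).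
  by rewrite subrr mulr0.
have [xu|xu] := boolP (x \in line u); last first.
  have G0 y : y \in children x -> reinforced H' y *
      (hitting u (y :: H') - hitting u H') = 0.
    move=> yx; have yu : y \notin line u.
      by apply: contra xu; exact: children_line.
    have := yx; rewrite mem_children => /andP[y0 /eqP py].
    by rewrite /hitting seen_out //= (meet_out y0 yu) py subrr mulr0.
  rewrite (sum_nbs0 x0 G0) /hitting seen_in //= (meet_out x0 xu).
  by rewrite subrr mulr0.
have xk : (dep x <= seen u H')%N by rewrite seenE.
have [z zx zu] := line_child_in xu (leq_ltn_trans xk ku).
rewrite (sum_nbs1 x0 zx) => [|y yx yz]; last first.
  have yu : y \notin line u.
    by apply: contra yz => yu; apply/eqP; exact: line_child_unique yx zx yu zu.
  have := yx; rewrite mem_children => /andP[y0 /eqP py].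
  by rewrite /hitting seen_out //= (meet_out y0 yu) py subrr mulr0.
have h1 : hitting u H' = (dep x)%:R * coef (seen u H').
  by rewrite /hitting leqNgt ku /= meet_in.
have h2 : hitting u (par x :: H') = ((dep x)%:R - 1) * coef (seen u H').
  rewrite /hitting seen_in // leqNgt ku /= -(meet_parent xu) -natr1.
  by rewrite addrK.
have h3 : hitting u (z :: H') = (dep x).+1%:R * coef (seen u (z :: H')).
  rewrite /hitting /= (meet_in zu) (depth_children zx); case: ifP => // uk.
  have zH : z \notin H'.
    by apply: contraL uk => zH; rewrite seen_in // -ltnNge.
  have pz : par z = x by move: zx; rewrite mem_children => /andP[_ /eqP].
  have := seen_le u (z :: H'); rewrite (seen_cons_tip cH zu) ?pz // => zu'.
  suff -> : dep u = dep z by rewrite (depth_children zx).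
  by apply/eqP; rewrite eqn_leq zu' andbT; rewrite (seen_cons_tip cH zu) ?pz // in uk.
have := @child_advance u x z H' 0 cH xH xu zx zu; rewrite !addn0 h1 h2 h3 => ->.
by rewrite /reinforced pH -mulrBl addrAC subrr add0r mulN1r mulrN addNr.
Qed.

Definition pair_const m : R := 2 * m%:R * coef (m + m) ^+ 2 / coef m.

(* On the two branches the martingale of a single vertex is run with all depths
   shifted by [m]; this compensates the correlation created by the common trunk.
   The factor [pair_const m] makes both expressions agree when the separation
   point is reached for the first time. *)
Definition pair_hitting u v (H : seq V) : R :=
  let m := meet u v in let x := head root H in
  if (m <= seen u H)%N then
    m%:R * (meet u x + meet v x)%:R * coef (seen u H + m) * coef (seen v H + m)
  else pair_const m * (meet u x)%:R * coef (seen u H).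

Lemma branch_vertex u v : (0 < meet u v)%N ->
  exists b, [/\ b \in line u, b \in line v & dep b = meet u v].
Proof.
elim/line_ind: u => [|u u0 IH]; first by rewrite meetC meet_root.
have [uv|uv] := boolP (u \in line v).
  by exists u; rewrite line_mem // uv meetC meet_in.
rewrite meetC (meet_out u0 uv) meetC => /IH[b [bu bv bm]].
by exists b; split; rewrite // lineE // inE bu orbT.
Qed.

Lemma seen_meet u v H : history_closed H ->
  (meet u v <= seen u H)%N = (meet u v <= seen v H)%N.
Proof.
move=> cH; have [->//|m0] := posnP (meet u v).
by have [b [bu bv <-]] := branch_vertex m0; rewrite !seenE.
Qed.

Lemma pair_hittingC u v H : history_closed H -> (meet u v <= seen u H)%N ->
  pair_hitting u v H = pair_hitting v u H.
Proof.
move=> cH mu; have mv : (meet u v <= seen v H)%N by rewrite -seen_meet.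
by rewrite /pair_hitting (meetC v u) mu mv addnC -!mulrA (mulrC (coef (seen u H + _))).
Qed.

Lemma history_closed_cons x y H : history_closed (x :: H) -> adj x y ->
  history_closed (y :: x :: H).
Proof.
move=> cH /adj_cases xy; split; first by rewrite inE (proj1 cH) orbT.
move=> z; rewrite inE => /predU1P[->|zH] z0; last by rewrite inE cH.2 ?orbT.
case: xy => [[x0 yE]|[y0 ->]]; last by rewrite !inE eqxx orbT.
rewrite inE; apply/orP; right; apply: (proj2 cH) => //.
by rewrite yE; apply: (proj2 cH) => //; exact: mem_head.
Qed.

(** Beyond the separation point on the side of [u], both [meet v] and [seen v] stay constant. What
    moves is the single-vertex martingale of [u] with depths shifted by [meet u v]. *)
Lemma pair_hitting_harmonic1 u v x H : history_closed (x :: H) -> x \in line u ->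
  x \notin line v -> (dep x < dep u)%N ->
  \sum_(y <- nbs x) reinforced (x :: H) y *
    (pair_hitting u v (y :: x :: H) - pair_hitting u v (x :: H)) = 0.
Proof.
move=> cH xu xv xltu; have x0 := mem_line_neq xu.
set H' := x :: H in cH *; have xH : x \in H' by exact: mem_head.
have pH : par x \in H' by apply: (cH.2 x).
have xk : (dep x <= seen u H')%N by rewrite seenE.
have mk : (meet u v <= seen u H')%N by rewrite (leq_trans _ xk) // ltnW // meet_lt.
have yv y : y \in children x -> y \notin line v.
  by move=> yx; apply: contra xv; exact: children_line.
have vx : meet v x = meet u v by rewrite (meet_branch xu xv) meetC.
have pairE y : pair_hitting u v (y :: H') = (meet u v)%:R *
    (meet u y + meet v y)%:R * coef (seen u (y :: H') + meet u v) *
    coef (seen v (y :: H') + meet u v).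
  by rewrite /pair_hitting (leq_trans mk (seen_mono _ _ _)).
have pair0E : pair_hitting u v H' = (meet u v)%:R * (dep x + meet u v)%:R *
    coef (seen u H' + meet u v) * coef (seen v H' + meet u v).
  by rewrite /pair_hitting mk /= (meet_in xu) vx.
have [z zx zu] := line_child_in xu xltu.
have vc y : y \in children x -> meet v y = meet u v.
  move=> yx; have := yx; rewrite mem_children => /andP[y0 /eqP py].
  by rewrite (meet_out y0 (yv y yx)) py.
rewrite (sum_nbs1 x0 zx) => [|y yx yz]; last first.
  have yu : y \notin line u.
    by apply: contra yz => yu; apply/eqP; exact: line_child_unique yx zx yu zu.
  have := yx; rewrite mem_children => /andP[y0 /eqP py].
  rewrite pairE pair0E (vc y yx) (meet_out y0 yu) py (meet_in xu).
  rewrite (seen_out _ yu) (seen_out _ (yv y yx)).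
  by rewrite subrr mulr0.
have := @child_advance u x z H' (meet u v) cH xH xu zx zu.
have dE : (dep x + meet u v)%:R = (meet u (par x) + meet u v)%:R + 1 :> R.
  by rewrite natr1 -addSn meet_parent.
rewrite !pairE pair0E !(seen_in _ pH) (seen_out _ (yv z zx)) (vc z zx) (meet_in zu).
rewrite (depth_children zx) addSn -(meet_out x0 xv) vx /reinforced pH.
move: (if _ then _ else _) (coef (seen u (z :: H') + _)) => w c.
move: (_.+1%:R : R) dE (meet u v)%:R => S; move: (_%:R : R) => D -> m adv.
transitivity (m * coef (seen v H' + meet u v) *
  (w * (S * c - ((meet u (par x) + meet u v)%:R + 1) * coef (seen u H' + meet u v))
   - delta * coef (seen u H' + meet u v))).
  by ring.
by rewrite adv subrr mulr0.
Qed.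

(** Before the separation point is visited, this is a multiple of the single-vertex martingale.
    Afterwards the next vertex of the trunk is already visited, both moves along the trunk have
    weight [delta], and the function is affine in the depth. *)
Lemma pair_hitting_harmonic_trunk u v x H : history_closed (x :: H) ->
  x \in line u -> x \in line v -> (dep x < meet u v)%N ->
  \sum_(y <- nbs x) reinforced (x :: H) y *
    (pair_hitting u v (y :: x :: H) - pair_hitting u v (x :: H)) = 0.
Proof.
move=> cH xu xv xm; have x0 := mem_line_neq xu.
set H' := x :: H in cH *; have xH : x \in H' by exact: mem_head.
have pH : par x \in H' by apply: (cH.2 x).
have xk : (dep x <= seen u H')%N by rewrite seenE.
have [|z zx zu] := line_child_in xu.
  by rewrite (leq_trans xm) // meetC meet_le.
have zv : z \in line v by rewrite (meet_child zu) // (depth_children zx).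
rewrite (sum_nbs1 x0 zx) => [|y yx yz]; last first.
  have yu : y \notin line u.
    by apply: contra yz => yu; apply/eqP; exact: line_child_unique yx zx yu zu.
  have yv : y \notin line v.
    by apply: contra yz => yv; apply/eqP; exact: line_child_unique yx zx yv zv.
  have := yx; rewrite mem_children => /andP[y0 /eqP py].
  rewrite /pair_hitting /= (meet_out y0 yu) (meet_out y0 yv) py.
  by rewrite (seen_out _ yu) (seen_out _ yv) subrr mulr0.
have pz : par z = x by move: zx; rewrite mem_children => /andP[_ /eqP].
rewrite /reinforced pH /pair_hitting /= !(seen_in _ pH) !(meet_in xu, meet_in xv).
rewrite (meet_in zu) (meet_in zv) (depth_children zx).
have dE : (dep x)%:R = (meet u (par x))%:R + 1 :> R by rewrite natr1 meet_parent.
have -> : meet v (par x) = meet u (par x).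
  by apply: succn_inj; rewrite !meet_parent.
have [mk|km] := leqP (meet u v) (seen u H').
  have zH : z \in H'.
    by rewrite -(seenE cH zu) (leq_trans _ mk) // (depth_children zx).
  rewrite zH !(seen_in _ zH) mk !natrD -natr1 dE.
  by ring.
have := @child_advance u x z H' 0 cH xH xu zx zu; rewrite !addn0 /reinforced => adv.
(* The move may be the first visit to the separation point, where [pair_hitting] changes formula.
   Then [z] has depth [meet u v], and [pair_const] makes the two values equal. *)
set w := (X in _ + X * _); have -> : (if (meet u v <= seen u (z :: H'))%N
     then (meet u v)%:R * ((dep x).+1 + (dep x).+1)%:R *
          coef (seen u (z :: H') + meet u v) * coef (seen v (z :: H') + meet u v)
     else pair_const (meet u v) * (dep x).+1%:R * coef (seen u (z :: H')))
  = pair_const (meet u v) * (dep x).+1%:R * coef (seen u (z :: H')).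
  case: ifP => // mk; have zH : z \notin H'.
    by apply: contraTN mk => zH; rewrite (seen_in _ zH) -ltnNge.
  have := mk; rewrite !(seen_cons_tip cH) ?pz // => mz.
  have -> : meet u v = dep z.
    by apply/eqP; rewrite eqn_leq mz (depth_children zx).
  rewrite /pair_const (depth_children zx) addnn -mul2n !natrM.
  have c0 : coef (dep x).+1 != 0 by rewrite gt_eqF // coef_gt0.
  by field.
transitivity (pair_const (meet u v) * (w * ((dep x).+1%:R * coef (seen u (z :: H')) -
   (dep x)%:R * coef (seen u H')) - delta * coef (seen u H'))).
  by rewrite -[(dep x).+1%:R]natr1 dE; ring.
by rewrite adv subrr mulr0.
Qed.

(** At the separation point a move to the parent lowers both depths at once, while a child raises
    only one. The loss is thus twice the gain of either branch, and the two branches together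
    balance it. *)
Lemma pair_hitting_harmonic_branch u v x H : history_closed (x :: H) ->
  x \in line u -> x \in line v -> dep x = meet u v ->
  (dep x < dep u)%N -> (dep x < dep v)%N ->
  \sum_(y <- nbs x) reinforced (x :: H) y *
    (pair_hitting u v (y :: x :: H) - pair_hitting u v (x :: H)) = 0.
Proof.
move=> cH xu xv xm xltu xltv; have x0 := mem_line_neq xu.
set H' := x :: H in cH *; have xH : x \in H' by exact: mem_head.
have pH : par x \in H' by apply: (cH.2 x).
have mk : (meet u v <= seen u H')%N by rewrite -xm seenE.
have [z zx zu] := line_child_in xu xltu; have [t tx tv] := line_child_in xv xltv.
have zv : z \notin line v.
  by apply/negP => /(meet_both zu); rewrite (depth_children zx) xm ltnn.
have tu : t \notin line u.
  by apply/negP => tu; move: (meet_both tu tv); rewrite (depth_children tx) xm ltnn.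
have zt : z != t by apply: contraNneq zv => ->.
have childP y : y \in children x -> y != root /\ par y = x.
  by rewrite mem_children => /andP[y0 /eqP].
rewrite (sum_nbs2 x0 zx tx zt) => [|y yx yz yt]; last first.
  have yu : y \notin line u.
    by apply: contra yz => yu; apply/eqP; exact: line_child_unique yx zx yu zu.
  have yv : y \notin line v.
    by apply: contra yt => yv; apply/eqP; exact: line_child_unique yx tx yv tv.
  have [y0 py] := childP y yx.
  rewrite /pair_hitting /= (meet_out y0 yu) (meet_out y0 yv) py.
  by rewrite (seen_out _ yu) (seen_out _ yv) subrr mulr0.
have [z0 pz] := childP z zx; have [t0 pt] := childP t tx.
have pairE y : pair_hitting u v (y :: H') = (meet u v)%:R *
    (meet u y + meet v y)%:R * coef (seen u (y :: H') + meet u v) *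
    coef (seen v (y :: H') + meet u v).
  by rewrite /pair_hitting (leq_trans mk (seen_mono _ _ _)).
have pair0E : pair_hitting u v H' = (meet u v)%:R * (meet u v + meet u v)%:R *
    coef (seen u H' + meet u v) * coef (seen v H' + meet u v).
  by rewrite /pair_hitting mk /= (meet_in xu) (meet_in xv) xm.
rewrite !pairE pair0E !(seen_in _ pH) (seen_out _ tu) (seen_out _ zv).
rewrite (meet_in zu) (meet_in tv) (meet_out z0 zv) (meet_out t0 tu) pz pt.
rewrite (meet_in xu) (meet_in xv) (depth_children zx) (depth_children tx).
have := @child_advance u x z H' (meet u v) cH xH xu zx zu.
have := @child_advance v x t H' (meet u v) cH xH xv tx tv.
have -> : meet v (par x) = meet u (par x).
  by apply: succn_inj; rewrite !meet_parent.
have dE : (meet u v)%:R = (meet u (par x))%:R + 1 :> R.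
  by rewrite natr1 -xm -(meet_parent xu).
have -> : reinforced H' (par x) = delta by rewrite /reinforced pH.
rewrite xm addnS !addSn.
move: (reinforced H' z) (reinforced H' t) => w w'.
rewrite -natr1 !natrD.
move: (coef (seen u (z :: H') + _)) (coef (seen v (t :: H') + _)) => c c'.
move: (coef (seen u H' + _)) (coef (seen v H' + _)) => a a'.
rewrite {}dE; move: (_%:R : R) => p adv' adv.
transitivity ((p + 1) * a' * (w * ((p + 1 + (p + 1) + 1) * c - (p + 1 + (p + 1)) * a)
     - delta * a)
  + (p + 1) * a * (w' * ((p + 1 + (p + 1) + 1) * c' - (p + 1 + (p + 1)) * a')
     - delta * a')); first by ring.
by rewrite adv adv' !subrr !mulr0 addr0.
Qed.

(** Unlike [hitting], the function [pair_hitting] is not frozen once a target is visited. The depth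
    hypotheses guarantee that a geodesic through [x] has a next vertex. *)
Lemma pair_hitting_harmonic u v x H : history_closed (x :: H) -> x != root ->
  (dep x < dep u)%N -> (dep x < dep v)%N ->
  \sum_(y <- nbs x) reinforced (x :: H) y *
    (pair_hitting u v (y :: x :: H) - pair_hitting u v (x :: H)) = 0.
Proof.
move=> cH x0 xltu xltv.
have [xu|xu] := boolP (x \in line u); have [xv|xv] := boolP (x \in line v).
- have := meet_both xu xv; rewrite leq_eqVlt => /orP[/eqP xm|xm].
    exact: pair_hitting_harmonic_branch.
  exact: pair_hitting_harmonic_trunk.
- exact: pair_hitting_harmonic1.
- have mk : (meet u v <= seen u (x :: H))%N.
    rewrite seen_meet // ltnW // (leq_trans (_ : _ < dep x)%N) //.
      by rewrite meetC meet_lt.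
    by rewrite seenE // mem_head.
  rewrite -[RHS](pair_hitting_harmonic1 cH xv xu xltv).
  apply: eq_big_seq => y; rewrite mem_nbs => xy.
  rewrite (@pair_hittingC u v (x :: H)) // (@pair_hittingC u v (y :: _)) //.
    exact: history_closed_cons.
  exact: leq_trans mk (seen_mono _ _ _).
- have lineP y : y \in children x ->
      [/\ y != root, par y = x, y \notin line u & y \notin line v].
    move=> yx; have := yx; rewrite mem_children => /andP[y0 /eqP py]; split=> //.
      by apply: contra xu; exact: children_line.
    by apply: contra xv; exact: children_line.
  rewrite (sum_nbs0 x0) => [|y /lineP[y0 py yu yv]].
    have pH : par x \in x :: H by apply: (cH.2 x); rewrite ?mem_head.
    rewrite /pair_hitting /= (meet_out x0 xu) (meet_out x0 xv) !(seen_in _ pH).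
    by rewrite subrr mulr0.
  rewrite /pair_hitting /= (meet_out y0 yu) (meet_out y0 yv) py.
  by rewrite (seen_out _ yu) (seen_out _ yv) subrr mulr0.
Qed.

(** * Domination of products of hitting functions by the pair function *)

Lemma meet_ultrametric u v x : (minn (meet u x) (meet v x) <= meet u v)%N.
Proof.
rewrite leqNgt leq_min; apply/negP => /andP[hu hv].
have [b [bu bx bm]] := branch_vertex (leq_ltn_trans (leq0n _) hu).
have [c [cv cx cm]] := branch_vertex (leq_ltn_trans (leq0n _) hv).
(* Two vertices of [line x] are comparable, so the shallower of [b] and [c] lies on the lines of
   both [u] and [v]. *)
have [bc|/ltnW cb] := leqP (dep b) (dep c).
  have bv := line_sub cv (line_comparable cx bx bc).
  by have := meet_both bu bv; rewrite bm leqNgt hu.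
have cu := line_sub bu (line_comparable bx cx cb).
by have := meet_both cu cv; rewrite cm leqNgt hv.
Qed.

Lemma coef_ge0 k : 0 <= coef k. Proof. by rewrite ltW // coef_gt0. Qed.

Lemma hitting_ge0 u H : 0 <= hitting u H.
Proof. by rewrite /hitting; case: ifP => _; rewrite mulr_ge0 ?coef_ge0. Qed.

Lemma pair_const_ge0 m : 0 <= pair_const m.
Proof. by rewrite divr_ge0 ?mulr_ge0 ?exprn_ge0 ?coef_ge0. Qed.

Lemma pair_hitting_ge0 u v H : 0 <= pair_hitting u v H.
Proof.
rewrite /pair_hitting; case: ifP => _; first by rewrite !mulr_ge0 ?coef_ge0.
by rewrite mulr_ge0 ?coef_ge0 // mulr_ge0 // pair_const_ge0.
Qed.

Lemma pair_const_ge m : (0 < m)%N -> m%:R * coef m <= 2 * pair_const m.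
Proof.
move=> m0; have c0 := coef_gt0 m delta_gt0; rewrite /pair_const mulrA.
rewrite ler_pdivlMr //.
have -> : m%:R * coef m * coef m = m%:R * coef m ^+ 2 by ring.
have h := coef_shift delta_gt0 m0 (leqnn m).
have -> : 2 * (2 * m%:R * coef (m + m) ^+ 2) = m%:R * (2 * coef (m + m)) ^+ 2.
  by rewrite exprMn; ring.
by rewrite ler_wpM2l // lerXn2r // nnegrE ?mulr_ge0 ?coef_ge0.
Qed.

(** This passes from second moments to a supermartingale. Neither target has been visited, so both
    factors are given by their running formula; the constant 4 is the square of the 2 in
    [coef_shift]. *)
Lemma hitting_mul_le u v x H : history_closed (x :: H) ->
  (seen u (x :: H) < dep u)%N -> (seen v (x :: H) < dep v)%N ->
  hitting u (x :: H) * hitting v (x :: H) <= 4 * pair_hitting u v (x :: H).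
Proof.
move=> cH ku kv; rewrite /hitting leqNgt ku leqNgt kv /=.
have mE := seen_meet u v cH; rewrite /pair_hitting /=.
have [m0|m0] := posnP (meet u v).
  have := meet_ultrametric u v x; rewrite m0 leqn0 leq0n => /eqP j0.
  have -> : (meet u x)%:R * coef (seen u (x :: H)) *
      ((meet v x)%:R * coef (seen v (x :: H))) = 0 :> R.
    rewrite mulrACA -natrM; suff -> : (meet u x * meet v x = 0)%N by rewrite mul0r.
    by move: j0; rewrite /minn; case: ifP => _ ->; rewrite ?muln0.
  by rewrite !mul0r mulr0.
case: ifP => mu.
  have mv : (meet u v <= seen v (x :: H))%N by rewrite -mE.
  have hu := coef_shift delta_gt0 (leq_trans m0 mu) mu.
  have hv := coef_shift delta_gt0 (leq_trans m0 mv) mv.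
  (* By [meet_ultrametric] one of the two factors is at most [meet u v]. *)
  have hj : (meet u x * meet v x <= meet u v * (meet u x + meet v x))%N.
    have := meet_ultrametric u v x; rewrite geq_min mulnDr => /orP[h|h].
      by rewrite (leq_trans (leq_mul h (leqnn _))) // leq_addl.
    by rewrite mulnC (leq_trans (leq_mul h (leqnn _))) // leq_addr.
  rewrite mulrACA.
  set a := coef (seen u _ + _); set b := coef (seen v _ + _).
  have -> : 4 * ((meet u v)%:R * (meet u x + meet v x)%:R * a * b) =
    (meet u v * (meet u x + meet v x))%:R * ((2 * a) * (2 * b)) :> R.
    by rewrite natrM; ring.
  rewrite -natrM; apply: ler_pM; rewrite ?ler_nat ?mulr_ge0 ?coef_ge0 //.
  by apply: ler_pM; rewrite ?coef_ge0.
have mv : (seen v (x :: H) < meet u v)%N by rewrite ltnNge -mE mu.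
(* Before the separation point is visited, the factor of [v] is at most its value for depth and
   maximum equal to [meet u v]; [pair_const_ge] then bounds it by a constant. *)
have hj : (meet v x)%:R * coef (seen v (x :: H)) <= (meet u v)%:R * coef (meet u v).
  rewrite (le_trans _ (coef_mono delta_gt0 (ltnW mv))) // ler_wpM2r ?coef_ge0 //.
  by rewrite ler_nat meet_le_seen // mem_head.
rewrite [leLHS]mulrC -(mulrA (pair_const _)) [leRHS]mulrA; apply: ler_wpM2r.
  by rewrite mulr_ge0 ?coef_ge0.
rewrite (le_trans hj) // (le_trans (pair_const_ge m0)) //.
by rewrite ler_wpM2r ?pair_const_ge0 // ler_nat.
Qed.

Lemma pair_const_le : exists2 K : R, 0 < K &
  forall m, pair_const m <= K * (m%:R * coef m).
Proof.
(* The three factors come from [coef_upper] at [2 m], from doubling inside the power, and from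
   [coef_lower] at [m]; together they give [2 * coef (2 m) <= K * coef m]. *)
pose K : R := (1 + delta) * 2 `^ delta * (1 + delta) `^ delta.
have d1 : 0 < 1 + delta by rewrite addr_gt0.
have K0 : 0 < K by rewrite !mulr_gt0 ?powR_gt0.
exists (K ^+ 2); first by rewrite exprn_gt0.
case=> [|n]; first by rewrite /pair_const mulr0 !mul0r mulr0.
have n1 : 0 < n.+1%:R :> R by rewrite ltr0n.
have c0 := coef_gt0 n.+1 delta_gt0.
have h : 2 * coef (n.+1 + n.+1) <= K * coef n.+1.
  rewrite -(ler_pM2l n1) [leLHS]mulrA [leLHS]mulrAC mulrC mulrA.
  have nn : (n + n.+1).+1%:R = 2 * n.+1%:R :> R.
    by rewrite -addSn addnn -mul2n natrM.
  have := coef_upper (n + n.+1) delta_gt0; rewrite nn => h.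
  rewrite addSn.
  rewrite (le_trans h) // powRM // mulrA.
  have := coef_lower n delta_gt0.
  rewrite -(ler_pM2l (_ : 0 < (1 + delta) * 2 `^ delta)); last first.
    by rewrite mulr_gt0 ?powR_gt0.
  by move=> /le_trans; apply; rewrite /K le_eqVlt; apply/orP; left; apply/eqP; ring.
rewrite /pair_const ler_pdivrMr //.
have -> : K ^+ 2 * (n.+1%:R * coef n.+1) * coef n.+1 = n.+1%:R * (K * coef n.+1) ^+ 2.
  by ring.
rewrite (le_trans (_ : _ <= n.+1%:R * (2 * coef (n.+1 + n.+1)) ^+ 2)) //.
  set x := coef _.
  have -> : n.+1%:R * (2 * x) ^+ 2 = 2 * (2 * n.+1%:R * x ^+ 2) by ring.
  have x0 : 0 <= x by exact: coef_ge0.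
  have : 0 <= 2 * n.+1%:R * x ^+ 2 by rewrite -natrM mulr_ge0 ?ler0n ?sqr_ge0.
  by move: (2 * n.+1%:R * x ^+ 2) => y; lra.
by rewrite ler_pM2l // lerXn2r // nnegrE mulr_ge0 ?coef_ge0 // ltW.
Qed.

Lemma line_at u i : (i < dep u)%N -> exists2 w, w \in line u & dep w = i.+1.
Proof.
elim/line_ind: u => [|u u0 IH]; first by rewrite depth_root.
rewrite leq_eqVlt => /orP[/eqP iu|]; first by exists u; rewrite // line_mem.
rewrite {1}(depth_parent u0) ltnS => /IH[w wu wi].
by exists w; rewrite // lineE // inE wu orbT.
Qed.

End harmonic.

(** * Flows *)

Section flow.
Context (R : realType) (c : V -> R) (L : nat).
Hypothesis c_gt0 : forall v, 0 < c v.

Let below v u := v \in root :: line u.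

Lemma below_refl v : below v v.
Proof. by rewrite /below inE; have [//|v0] := eqVneq v root; rewrite line_mem. Qed.

Lemma below_line v u : below v u -> {subset root :: line v <= root :: line u}.
Proof.
rewrite /below inE => /predU1P[->|vu] z.
  by rewrite line_root inE => /eqP ->; rewrite mem_head.
by rewrite !inE => /predU1P[->|/(line_sub vu) ->]; rewrite ?eqxx ?orbT.
Qed.

Lemma below_depth v u : below v u -> (dep v <= dep u)%N.
Proof.
rewrite /below inE => /predU1P[->|/mem_line_depth/andP[]//].
by rewrite depth_root.
Qed.

Lemma below_comparable u v w : below u w -> below v w -> (dep u <= dep v)%N ->
  below u v.
Proof.
rewrite /below !inE => /predU1P[->|uw]; first by rewrite eqxx.
move=> /predU1P[->|vw] uv; last by rewrite (line_comparable vw uw uv) orbT.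
by move: uv; rewrite depth_root leqn0 depth_eq0 => ->.
Qed.

Lemma below_eq u v : below u v -> (dep v <= dep u)%N -> u = v.
Proof.
rewrite /below inE => /predU1P[->|uv vu]; last exact: mem_line_eq uv vu.
by rewrite depth_root leqn0 depth_eq0 => /eqP.
Qed.

Lemma ray_depth nu i : is_ray adj root nu ->
  dep (nu i) = i /\ (nu i.+1 != root /\ par (nu i.+1) = nu i).
Proof.
case=> nu0 nuadj nuinj; elim: i => [|i [IH1 [IH2 IH3]]].
  rewrite nu0 depth_root; split=> //; have := nuadj 0%N; rewrite nu0 => /adj_cases[[]|[]].
    by rewrite eqxx.
  by move=> y0 <-.
have d : dep (nu i.+1) = i.+1 by rewrite (depth_parent IH2) IH3 IH1.
split=> //; case: (adj_cases (nuadj i.+1)) => [[_ h]|[h1 h2]]; last by split.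
have := nuinj i.+2 i; rewrite h IH3 => /(_ erefl) /eqP.
by rewrite -[X in _ == X]addn0 -addn2 eqn_add2l.
Qed.

Lemma ray_line nu i u : is_ray adj root nu -> below u (nu i) -> u = nu (dep u).
Proof.
move=> rnu; elim: i => [|i IH].
  case: (rnu) => nu0 _ _; rewrite /below nu0 line_root inE => /eqP ->.
  by rewrite depth_root nu0.
have [d [i0 ip]] := ray_depth i rnu; have [d' _] := ray_depth i.+1 rnu.
rewrite /below lineE // !inE => /or3P[/eqP ->|/eqP ->|].
- by rewrite depth_root; case: rnu.
- by rewrite d'.
- by rewrite ip => ui; apply: IH; rewrite /below inE ui orbT.
Qed.

(* [pi] is a cut below [v] and [theta] lists the endpoints at depth [L] of a
   flow from [v], with the amounts they receive; equality in the fourth clause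
   is the max-flow min-cut theorem. *)
Definition flow_cut v (pi : seq V) (theta : seq (V * R)) : Prop :=
  [/\ forall u, u \in pi -> below v u,
      forall nu, is_ray adj root nu -> nu (dep v) = v ->
        (exists i, nu i \in pi) /\
        (forall i j, nu i \in pi -> nu j \in pi -> i = j),
      forall p, p \in theta -> [/\ dep p.1 = L, below v p.1 & 0 <= p.2],
      \sum_(u <- pi) c u = \sum_(p <- theta) p.2 &
      forall u, (dep v <= dep u)%N ->
        \sum_(p <- theta | below u p.1) p.2 <= c u].

(** Max-flow min-cut on a tree, by induction on the height [r] left below [v]: the cuts and flows of
    the children are concatenated, then compared with the capacity of [v]. A vertex with no
    descendant at depth [L] gets an empty cut and an empty flow. *)
Lemma finite_flow_cut r v : (dep v + r = L)%N ->
  exists pi theta, flow_cut v pi theta.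
Proof.
elim: r v => [|r IH] v vL.
  rewrite addn0 in vL; exists [:: v], [:: (v, c v)]; split.
  - by move=> u; rewrite inE => /eqP ->; exact: below_refl.
  - move=> nu rnu nuv; split; first by exists (dep v); rewrite nuv inE.
    move=> i j; rewrite !inE => /eqP iv /eqP jv.
    by rewrite -(proj1 (ray_depth i rnu)) -(proj1 (ray_depth j rnu)) iv jv.
  - by move=> p; rewrite inE => /eqP -> /=; split; rewrite ?below_refl // ltW.
  - by rewrite !big_seq1.
  - move=> u vu; rewrite big_cons big_nil /=; case: ifP => uv; last exact: ltW.
    by rewrite addr0 (below_eq uv vu).
have /choice[pif pifP] : forall y, exists pt : seq V * seq (V * R),
    y \in children v -> flow_cut y pt.1 pt.2.
  move=> y; have [yv|_] := boolP (y \in children v); last by exists ([::], [::]).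
  have [|pi [theta piP]] := IH y; first by rewrite (depth_children yv) addSnnS.
  by exists (pi, theta).
have belowS y u : y \in children v -> below y u -> below v u.
  move=> yv yu; apply: (below_line yu); move: yv; rewrite mem_children => /andP[y0 /eqP <-].
  rewrite lineE // !inE; have [//|p0] := eqVneq (par y) root.
  by rewrite line_mem ?orbT.
pose pi := flatten [seq (pif y).1 | y <- children v].
pose theta := flatten [seq (pif y).2 | y <- children v].
have piE : \sum_(u <- pi) c u = \sum_(p <- theta) p.2.
  rewrite !big_flatten !big_map; apply: eq_big_seq => y yv.
  by have [] := pifP y yv.
have pi_below u : u \in pi -> below v u.
  move=> /flattenP[s /mapP[y yv ->] us]; apply: (belowS y) => //.
  by have [h _ _ _ _] := pifP y yv; exact: h.
have thetaP p : p \in theta -> [/\ dep p.1 = L, below v p.1 & 0 <= p.2].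
  move=> /flattenP[s /mapP[y yv ->] ps]; have [_ _ h _ _] := pifP y yv.
  by have [-> pb ->] := h p ps; split=> //; exact: belowS pb.
have theta_le u : (dep v < dep u)%N -> \sum_(p <- theta | below u p.1) p.2 <= c u.
  move=> vu; rewrite big_flatten big_map.
  have g0 y : y \in children v -> ~~ below y u ->
      \sum_(p <- (pif y).2 | below u p.1) p.2 = 0.
    move=> yv yu; rewrite big_seq_cond big1 // => p /andP[py up].
    have [_ _ /(_ p py)[_ yp _] _ _] := pifP y yv.
    move: yu; rewrite (below_comparable yp up) //.
    by rewrite (depth_children yv).
  have [/hasP[y yv yu]|/hasPn nyu] := boolP (has (below^~ u) (children v)).
    rewrite (sum_children1 yv) => [|z zv zy].
      have [_ _ _ _] := pifP y yv; apply; exact: below_depth.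
    apply: g0 => //; apply: contra zy => zu; apply/eqP.
    apply: (below_eq (below_comparable zu yu _)).
      by rewrite (depth_children yv) (depth_children zv).
    by rewrite (depth_children yv) (depth_children zv).
  by rewrite big_seq big1 ?ltW // => y yv; rewrite g0 // nyu.
have ray_unique nu : is_ray adj root nu -> nu (dep v) = v ->
    (exists i, nu i \in pi) /\ (forall i j, nu i \in pi -> nu j \in pi -> i = j).
  move=> rnu nuv; have [d [y0 py]] := ray_depth (dep v) rnu.
  set y := nu (dep v).+1 in y0 py.
  have yv : y \in children v by rewrite mem_children y0 py nuv eqxx.
  have nuy : nu (dep y) = y by rewrite (depth_children yv).
  have [_ /(_ nu rnu nuy)[[i iy] uy] _ _ _] := pifP y yv.
  have piy k : nu k \in pi -> nu k \in (pif y).1.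
    move=> /flattenP[s /mapP[z zv ->] ks]; have [h _ _ _ _] := pifP z zv.
    have zE := ray_line rnu (h _ ks).
    by rewrite /y -(depth_children zv) -zE.
  split; last by move=> j k /piy jy /piy; exact: uy.
  by exists i; apply/flattenP; exists (pif y).1 => //; apply: map_f.
have sum0 u : (dep v <= dep u)%N -> (dep u <= dep v)%N -> u != v ->
    forall s : seq (V * R), (forall p, p \in s -> below v p.1) ->
    \sum_(p <- s | below u p.1) p.2 = 0.
  move=> vu uv uneqv s sP; rewrite big_seq_cond big1 // => p /andP[/sP vp up].
  move: uneqv; rewrite (below_eq (below_comparable up vp uv)) ?eqxx //.
(* If the flow of the children fits through [v], it is kept together with their cuts. Otherwise [v]
   alone becomes the cut and the flow is scaled down to total [c v]. *)
have [vS|Sv] := leP (c v) (\sum_(p <- theta) p.2); last first.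
  exists pi, theta; split=> // u; rewrite leq_eqVlt => /orP[/eqP vu|]; last exact: theta_le.
  have [->|uneqv] := eqVneq u v.
    rewrite (le_trans _ (ltW Sv)) // [leLHS]big_mkcond /=.
    rewrite !(big_seq _ _ _ (fun p => p.2)) !big_seq /=; apply: ler_sum => p /thetaP[_ _ p0].
    by case: ifP.
  by rewrite sum0 ?vu ?ltW // => p /thetaP[].
set S := \sum_(p <- theta) p.2 in vS piE; have S0 : 0 < S := lt_le_trans (c_gt0 v) vS.
pose theta' := [seq (p.1, p.2 * (c v / S)) | p <- theta].
have cS0 : 0 <= c v / S by rewrite divr_ge0 // ltW.
have cS1 : c v / S <= 1 by rewrite ler_pdivrMr // mul1r.
have theta'P p : p \in theta' -> [/\ dep p.1 = L, below v p.1 & 0 <= p.2].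
  by move=> /mapP[q /thetaP[q1 q2 q3] ->] /=; rewrite mulr_ge0.
exists [:: v], theta'; split=> //.
- by move=> u; rewrite inE => /eqP ->; exact: below_refl.
- move=> nu rnu nuv; split; first by exists (dep v); rewrite nuv inE.
  move=> i j; rewrite !inE => /eqP iv /eqP jv.
  by rewrite -(proj1 (ray_depth i rnu)) -(proj1 (ray_depth j rnu)) iv jv.
- by rewrite big_seq1 big_map -mulr_suml -/S mulrC divfK // gt_eqF.
move=> u; rewrite leq_eqVlt => /orP[/eqP vu|vu]; last first.
  rewrite big_map -mulr_suml (le_trans _ (theta_le u vu)) //= ler_piMr //.
  by rewrite big_seq_cond sumr_ge0 // => p /andP[/thetaP[]].
have [->|uneqv] := eqVneq u v; last by rewrite sum0 ?vu ?ltW // => p /theta'P[].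
rewrite big_map -mulr_suml /= -[leRHS](divfK (lt0r_neq0 S0)) mulrC ler_wpM2l //.
rewrite /S [leLHS]big_mkcond !big_seq /=; apply: ler_sum => p /thetaP[_ _ p0].
by case: ifP.
Qed.

End flow.

Lemma sum_undup_le (R : realType) (f : V -> R) (s : seq V) :
  (forall x, 0 <= f x) -> \sum_(x <- undup s) f x <= \sum_(x <- s) f x.
Proof.
move=> f0; elim: s => //= x s IH; rewrite big_cons; case: ifP => _.
  by rewrite (le_trans IH) // lerDr.
by rewrite big_cons lerD2l.
Qed.

Lemma flow_exists (R : realType) (lambda eps : R) L : 0 < eps ->
  (forall pi, cutsets adj root pi -> (eps%:E <= cutset_sum adj root lambda pi)%E) ->
  exists theta : seq (V * R),
  [/\ forall p, p \in theta -> dep p.1 = L /\ 0 <= p.2,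
      Num.min eps 1 <= \sum_(p <- theta) p.2 &
      forall u, u != root ->
        \sum_(p <- theta | u \in line p.1) p.2 <= (dep u)%:R `^ (- lambda)].
Proof.
move=> eps0 cut.
(* No edge lies above the root; its conventional capacity 1 is what produces the minimum with 1,
   when the cut contains the root. *)
pose c u : R := if u == root then 1 else (dep u)%:R `^ (- lambda).
have c0 u : 0 < c u.
  rewrite /c; case: ifP => // /negbT u0; rewrite powR_gt0 // ltr0n.
  by rewrite lt0n depth_eq0.
have [|pi [theta [_ rayP thetaP piE capP]]] := @finite_flow_cut R c L c0 L root.
  by rewrite depth_root.
exists theta; split.
- by move=> p /thetaP[].
- rewrite -piE; have [rpi|rpi] := boolP (root \in pi).
    rewrite ge_min; apply/orP; right; rewrite (big_rem root) //= {1}/c eqxx lerDl.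
    by rewrite sumr_ge0 // => u _; exact: ltW.
  rewrite ge_min; apply/orP; left.
  (* A vertex cut avoiding the root becomes a cutset by replacing each vertex with the edge to its
     parent. *)
  pose P := [set` [seq (par u, u) | u <- undup pi]].
  have nroot u : u \in pi -> u != root by apply: contraTneq => ->.
  have PP e : P e -> exists2 u, u \in pi & e = (par u, u).
    by move=> /mapP[u]; rewrite mem_undup => upi ->; exists u.
  have : cutsets adj root P.
    split=> [e /PP[u upi ->]|nu rnu].
      split; first by rewrite /= adjC parent_adj ?nroot.
      by rewrite /= -depth_parent ?nroot.
    have [|[i ipi] uniqP] := rayP nu rnu; first by rewrite depth_root; case: rnu.
    have i0 : (0 < i)%N.
      rewrite lt0n; apply: contraNneq rpi => iE; move: ipi; rewrite iE.
      by case: rnu => ->.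
    case: i i0 ipi => // i _ ipi; have [_ [i1 ip]] := ray_depth i rnu.
    exists i.+1; split.
      split=> //; exists (nu i, nu i.+1); last by left.
      by rewrite -ip /P /= ; apply/mapP; exists (nu i.+1); rewrite ?mem_undup.
    move=> [|j] [// _ [e /PP[u upi ->]]] []; last first.
      move=> [pu uE]; have [d _] := ray_depth j rnu; have [d' _] := ray_depth j.+1 rnu.
      have := depth_parent (nroot u upi); rewrite pu d' uE /= d => /eqP.
      by rewrite -[X in X == _]addn0 -addn2 eqn_add2l.
    by move=> [_ uE]; apply: uniqP; rewrite // -uE.
  move=> /cut/le_trans h; rewrite -lee_fin; apply: h.
  rewrite /cutset_sum esum_fset; [|exact: finite_seq|]; last first.
    by move=> e _; rewrite lee_fin powR_ge0.
  rewrite -fsbig_seq; last first.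
    by rewrite map_inj_uniq ?undup_uniq // => u v [].
  rewrite big_map sumEFin lee_fin.
  rewrite (le_trans _ (sum_undup_le _ (fun u => ltW (c0 u)))) //.
  rewrite le_eqVlt; apply/orP; left; apply/eqP; apply: eq_big_seq => u.
  by rewrite mem_undup => /nroot u0; rewrite /c (negPf u0).
- move=> u u0; have := capP u; rewrite depth_root => /(_ isT).
  by rewrite /c (negPf u0); under eq_bigl do rewrite inE (negPf u0).
Qed.

(** With [coef_sum] the weight of a pair is spread over the levels above its separation. After
    exchanging sums, the inner one is the flow through the vertex of that level on [line p.1],
    bounded by its capacity, and [coef_energy] sums the levels. *)
Lemma pair_energy (R : realType) (delta lambda : R) L (theta : seq (V * R)) :
  0 < delta -> delta < lambda ->
  (forall p, p \in theta -> dep p.1 = L /\ 0 <= p.2) ->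
  (forall u, u != root ->
    \sum_(p <- theta | u \in line p.1) p.2 <= (dep u)%:R `^ (- lambda)) ->
  \sum_(p <- theta) \sum_(r <- theta)
     p.2 * r.2 * ((meet p.1 r.1)%:R * coef delta (meet p.1 r.1))
  <= (1 + delta * ((1 + lambda) ^+ 2 / (lambda - delta))) * \sum_(p <- theta) p.2.
Proof.
move=> d0 dl thetaP capP; rewrite mulr_sumr !big_seq; apply: ler_sum => p pth.
have [pL p0] := thetaP p pth.
under eq_bigr do rewrite -mulrA.
rewrite -mulr_sumr mulrC ler_wpM2r //.
have mE r : (meet p.1 r.1)%:R * coef delta (meet p.1 r.1) =
    \sum_(i < L | (i < meet p.1 r.1)%N) delta * coef delta i.
  rewrite coef_sum // (big_ord_widen L (fun i => delta * coef delta i)) //.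
  by rewrite meetC -pL meet_le.
have -> : \sum_(r <- theta) r.2 * ((meet p.1 r.1)%:R * coef delta (meet p.1 r.1)) =
    \sum_(i < L) delta * coef delta i * \sum_(r <- theta | (i < meet p.1 r.1)%N) r.2.
  under eq_bigr do rewrite mE mulr_sumr big_mkcond.
  rewrite exchange_big /=; apply: eq_bigr => i _.
  rewrite mulr_sumr [RHS]big_mkcond; apply: eq_bigr => r _.
  by case: ifP => _ //; rewrite mulrC.
have capi i : (i < L)%N ->
    \sum_(r <- theta | (i < meet p.1 r.1)%N) r.2 <= i.+1%:R `^ (- lambda).
  rewrite -pL => /line_at[w wp wi]; rewrite -wi (le_trans _ (capP w _)) //; last first.
    exact: mem_line_neq wp.
  rewrite big_mkcond [leRHS]big_mkcond !big_seq; apply: ler_sum => r /thetaP[_ r0].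
  case: ifP => [im|_]; last by case: ifP.
  by rewrite (meet_child wp) // wi.
rewrite (le_trans (_ : _ <= \sum_(i < L) delta * coef delta i * i.+1%:R `^ (- lambda))) //.
  apply: ler_sum => i _; rewrite ler_wpM2l ?capi //.
  by rewrite mulr_ge0 // ltW // coef_gt0.
have cc i : 0 <= coef delta i by rewrite ltW // coef_gt0.
case: L {thetaP pL mE capi} => [|L].
  rewrite big_ord0 addr_ge0 // mulr_ge0 ?ltW // divr_gt0 ?subr_gt0 //.
  by rewrite exprn_gt0 // addr_gt0 // (lt_trans d0).
(* The first level contributes exactly 1, as [coef delta 0] is the inverse of [delta]; the other
   levels form the remaining constant. *)
rewrite big_ord_recl /= powR1 mulr1; apply: lerD.
  by rewrite mulrV ?unitfE ?gt_eqF.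
under eq_bigr do rewrite -mulrA.
rewrite -mulr_sumr ler_wpM2l ?(ltW d0) // (le_trans _ (coef_energy L d0 dl)) //.
apply: ler_sum => i _; rewrite /bump /= add1n ler_wpM2l // !powRN.
rewrite lef_pV2 ?posrE ?powR_gt0 // ge0_ler_powR ?nnegrE ?ler_nat //.
by rewrite ltW // (lt_trans d0).
Qed.

(** * Walks before their return to the root *)

(* Histories of the walk are listed with the most recent vertex first. *)
Fixpoint paths n : seq (seq V) :=
  if n is n'.+1 then
    flatten [seq [seq y :: s | y <- nbs (head root s) & y != root] | s <- paths n']
  else [:: [:: root]].

Lemma pathsS n s : s \in paths n.+1 ->
  exists y s', [/\ s = y :: s', s' \in paths n, adj (head root s') y & y != root].
Proof.
move=> /flattenP[t /mapP[s' s'n ->] /mapP[y]]; rewrite mem_filter mem_nbs.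
by move=> /andP[y0 ay] ->; exists y, s'.
Qed.

Lemma mem_pathsS n y s : s \in paths n -> adj (head root s) y -> y != root ->
  y :: s \in paths n.+1.
Proof.
move=> sn ay y0; apply/flattenP.
exists [seq y :: s | y <- nbs (head root s) & y != root]; first exact: map_f.
by apply: map_f; rewrite mem_filter y0 mem_nbs.
Qed.

Lemma paths_size n s : s \in paths n -> size s = n.+1.
Proof.
elim: n s => [|n IH] s; first by rewrite inE => /eqP ->.
by move=> /pathsS[y [s' [-> /IH /= -> _ _]]].
Qed.

Lemma paths_cons n s : s \in paths n -> exists x t, s = x :: t.
Proof. by move=> /paths_size; case: s => // x t _; exists x, t. Qed.

Lemma paths_uniq n : uniq (paths n).
Proof.
elim: n => // n IH; apply/allpairs_uniq_dep => //.
- by move=> s _; rewrite filter_uniq // nbs_uniq.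
- by move=> [s y] [t z] _ _ /= [-> ->].
Qed.

Lemma paths_head n s : s \in paths n.+1 -> head root s != root.
Proof. by move=> /pathsS[y [s' [-> _ _ y0]]]. Qed.

Lemma paths_closed n s : s \in paths n -> history_closed s.
Proof.
elim: n s => [|n IH] s.
  rewrite inE => /eqP ->; split; first exact: mem_head.
  by move=> y; rewrite inE => ->.
move=> /pathsS[y [s' [-> s'n ay _]]]; have [x [t sE]] := paths_cons s'n.
by rewrite sE in s'n ay *; apply: history_closed_cons => //; exact: IH.
Qed.

Lemma paths_depth n s u : s \in paths n -> u \in s -> (dep u <= n)%N.
Proof.
elim: n s u => [|n IH] s u.
  by rewrite inE => /eqP ->; rewrite inE => /eqP ->; rewrite depth_root.
move=> /pathsS[y [s' [-> s'n ay _]]]; rewrite inE => /predU1P[->|us'].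
  rewrite (leq_trans (depth_adj ay)) // ltnS (IH s') //.
  by have [x [t ->]] := paths_cons s'n; exact: mem_head.
by rewrite (leq_trans (IH _ _ s'n us')).
Qed.

Fixpoint level n : seq V :=
  if n is n'.+1 then flatten [seq children x | x <- level n'] else [:: root].

Lemma mem_level n x : dep x = n -> x \in level n.
Proof.
elim: n x => [|n IH] x.
  by move/eqP; rewrite depth_eq0 inE.
move=> dx; have x0 : x != root by rewrite -depth_eq0 dx.
apply/flattenP; exists (children (par x)); last by rewrite mem_children x0 eqxx.
by apply: map_f; apply: IH; have := depth_parent x0; rewrite dx => -[].
Qed.

Lemma ball_degree D : exists K, forall x, (dep x <= D)%N -> (size (nbs x) <= K)%N.
Proof.
exists (\max_(i < D.+1) \max_(x <- level i) size (nbs x)) => x xD.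
have xi : x \in level (Ordinal (xD : (dep x < D.+1)%N)) by exact: mem_level.
apply: leq_trans (leq_bigmax (Ordinal (xD : (dep x < D.+1)%N))).
exact: (@leq_bigmax_seq _ _ xpredT (fun x => size (nbs x)) x xi).
Qed.

(** * Expectations over finite histories *)

Section chain.
Context (R : realType) (delta : R).
Hypothesis delta_gt0 : 0 < delta.
Local Notation reinforced' := (reinforced delta).

Definition total s : R := \sum_(z <- nbs (head root s)) reinforced' s z.

(** [q s] stands for the probability of the history [s]. Only finite sums occur here; [path_prob]
    later satisfies the hypotheses. *)
Context (q : seq V -> R).
Hypothesis q_ge0 : forall s, 0 <= q s.
Hypothesis q_root : q [:: root] = 1.
Hypothesis q_step : forall n s y, s \in paths n -> adj (head root s) y ->
  q (y :: s) = q s * (reinforced' s y / total s).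

(* Sums over walks which have not returned to the root: [expect n F] is the
   expectation of [F] at time [n] on the event [T(root) > n]. *)
Definition expect n (F : seq V -> R) : R := \sum_(s <- paths n) q s * F s.

Lemma reinforced_gt0 s y : 0 < reinforced' s y.
Proof. by rewrite /reinforced; case: ifP. Qed.

Lemma expectS n F : expect n.+1 F = \sum_(s <- paths n) q s *
  \sum_(y <- nbs (head root s) | y != root) reinforced' s y / total s * F (y :: s).
Proof.
rewrite /expect big_flatten big_map; apply: eq_big_seq => s sn.
rewrite big_map big_filter mulr_sumr big_seq_cond [RHS]big_seq_cond.
apply: eq_bigr => y /andP[]; rewrite mem_nbs => ay _.
by rewrite (@q_step n) // !mulrA.
Qed.

Lemma expect_sum n (I : Type) (r : seq I) (F : I -> seq V -> R) (a : I -> R) :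
  expect n (fun s => \sum_(i <- r) a i * F i s) = \sum_(i <- r) a i * expect n (F i).
Proof.
rewrite /expect; under eq_bigr do rewrite mulr_sumr; rewrite exchange_big /=.
by apply: eq_bigr => i _; rewrite mulr_sumr; apply: eq_bigr => s _; rewrite mulrCA.
Qed.

Definition harmonic_at (F : seq V -> R) s :=
  \sum_(y <- nbs (head root s)) reinforced' s y * (F (y :: s) - F s) = 0.

Lemma total_gt0 s x : x \in nbs (head root s) -> 0 < total s.
Proof.
move=> xs; rewrite /total (big_rem x) //= ltr_wpDr ?reinforced_gt0 //.
by rewrite sumr_ge0 // => y _; rewrite ltW // reinforced_gt0.
Qed.

Lemma paths_parent n s : s \in paths n.+1 -> par (head root s) \in nbs (head root s).
Proof. by move=> sn; rewrite mem_nbs parent_adj // (paths_head sn). Qed.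

Lemma harmonic_mean n F s : s \in paths n.+1 -> harmonic_at F s ->
  \sum_(y <- nbs (head root s)) reinforced' s y / total s * F (y :: s) = F s.
Proof.
move=> sn; have W0 := total_gt0 (paths_parent sn); rewrite /harmonic_at.
under eq_bigr do rewrite mulrBr; rewrite sumrB -mulr_suml -/(total s) => /eqP.
rewrite subr_eq0 => /eqP h; under eq_bigr do rewrite mulrAC.
by rewrite -mulr_suml h mulrAC mulfV ?mul1r // gt_eqF.
Qed.

(** Killing the walk at the root only discards non-negative terms. Times start at 1, from which on
    the current vertex is not the root. *)
Lemma expect_harmonic_le n F : (forall s, 0 <= F s) ->
  (forall s, s \in paths n.+1 -> harmonic_at F s) ->
  expect n.+2 F <= expect n.+1 F.
Proof.
move=> F0 Fh; rewrite expectS /expect !big_seq; apply: ler_sum => s sn.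
rewrite ler_wpM2l // -[leRHS](harmonic_mean sn (Fh s sn)) big_mkcond /=.
apply: ler_sum => y _; case: ifP => // _.
by rewrite mulr_ge0 // divr_ge0 // ltW ?reinforced_gt0 ?(total_gt0 (paths_parent sn)).
Qed.

Lemma expect_harmonic_eq n F : (forall s, s \in paths n.+1 -> F (root :: s) = 0) ->
  (forall s, s \in paths n.+1 -> harmonic_at F s) ->
  expect n.+2 F = expect n.+1 F.
Proof.
move=> F0 Fh; rewrite expectS /expect; apply: eq_big_seq => s sn.
rewrite -[X in _ = _ * X](harmonic_mean sn (Fh s sn)) big_mkcond /=.
congr (_ * _); apply: eq_bigr => y _; case: eqP => // ->.
by rewrite /= F0 // mulr0.
Qed.

Local Notation hitting' := (hitting delta).
Local Notation pair_hitting' := (pair_hitting delta).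
Local Notation pair_const' := (pair_const delta).

Lemma paths1 s : s \in paths 1 -> exists2 y, y \in children root & s = [:: y; root].
Proof.
move=> /pathsS[y [s' [-> ]]]; rewrite inE => /eqP -> /= ry y0; exists y => //.
by rewrite -(perm_mem nbs_root) mem_nbs.
Qed.

Lemma expect1 F : expect 1 F =
  (size (nbs root))%:R^-1 * \sum_(y <- children root) F [:: y; root].
Proof.
rewrite expectS big_seq1 q_root mul1r /= (perm_big _ nbs_root) mulr_sumr /=.
have rE y : y \in children root -> reinforced' [:: root] y = 1.
  by rewrite mem_children /reinforced inE => /andP[/negPf ->].
have -> : total [:: root] = (size (nbs root))%:R.
  rewrite /total /= (perm_size nbs_root) (perm_big _ nbs_root) /=.
  by rewrite (eq_big_seq _ rE) big_const_seq count_predT iter_addr_0.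
rewrite big_seq_cond [RHS]big_seq; apply: eq_big => [y|y /andP[/rE -> _]].
  by case yr: (y \in children root) => //=; move: yr; rewrite mem_children => /andP[].
by rewrite mul1r.
Qed.

Lemma seen_start u y : y \in children root -> u != root ->
  seen u [:: y; root] = (y \in line u).
Proof.
move=> yr u0; have cr : history_closed [:: root] by apply: (@paths_closed 0); exact: mem_head.
case: (boolP (y \in line u)) => [yu|yu].
  move: (yr); rewrite mem_children => /andP[y0 /eqP py].
  rewrite (seen_cons_tip cr yu) ?py ?mem_head ?inE //.
  by rewrite (depth_children yr) depth_root.
rewrite seen_out //; apply/eqP; rewrite /seen eqn0Ngt -has_count -all_predC.
by apply/allP => z /mem_line_neq /= z0; rewrite inE.
Qed.

Lemma hitting_start u y : y \in children root -> u != root ->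
  hitting' u [:: y; root] = (y \in line u)%:R.
Proof.
move=> yr u0; rewrite /hitting seen_start //=; case: (boolP (y \in line u)) => yu /=.
  rewrite meet_in // (depth_children yr) depth_root coef1 //.
  case: ifP => [|_]; last by rewrite mulr1.
  have : (0 < dep u)%N by rewrite lt0n depth_eq0.
  by case: (dep u) => [|[|]] //; rewrite coef1 ?mulr1.
move: yr; rewrite leqn0 depth_eq0 (negPf u0) mem_children => /andP[y0 /eqP py].
by rewrite (meet_out y0 yu) py meet_root mul0r.
Qed.

Lemma expect1_line u : u != root ->
  expect 1 (fun s => (head root s \in line u)%:R) = (size (nbs root))%:R^-1.
Proof.
move=> u0; rewrite expect1 -[RHS]mulr1; congr (_ * _).
have [|z [zu z0 pz]] := @line_child u root (mem_head _ _).
  by rewrite depth_root lt0n depth_eq0.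
have zr : z \in children root by rewrite mem_children z0 pz eqxx.
rewrite (sum_children1 zr) /= ?zu // => y yr yz.
by case: (boolP (y \in line u)) => // yu; rewrite (line_child_unique yr zr yu zu) eqxx in yz.
Qed.

Lemma expect1_hitting u : u != root ->
  expect 1 (hitting' u) = (size (nbs root))%:R^-1.
Proof.
move=> u0; rewrite -(expect1_line u0); apply: eq_big_seq => s /paths1[y yr ->].
by rewrite hitting_start.
Qed.

Lemma expect1_pair u v : u != root -> v != root ->
  expect 1 (pair_hitting' u v) <= (size (nbs root))%:R^-1 * pair_const' (meet u v).
Proof.
move=> u0 v0; rewrite mulrC -(expect1_line u0) /expect mulr_sumr !big_seq.
apply: ler_sum => s /paths1[y yr ->]; rewrite mulrCA ler_wpM2l //=.
have [y0 py] : y != root /\ par y = root.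
  by move: yr; rewrite mem_children => /andP[? /eqP].
have dy : dep y = 1%N by rewrite (depth_children yr) depth_root.
rewrite /pair_hitting !seen_start //=.
case: (posnP (meet u v)) => [->|m0]; first by rewrite !mul0r mulr_ge0 ?pair_const_ge0.
have [b [bu bv bm]] := branch_vertex m0.
have yuv : y \in line u -> y \in line v.
  by move=> yu; apply: (meet_child yu); rewrite dy.
case: (boolP (y \in line u)) => yu /=; last first.
  by rewrite leqNgt m0 /= (meet_out y0 yu) py meet_root mulr0n !mulr0 mul0r.
rewrite (yuv yu) (meet_in yu) dy mulr1 coef1 // !mulr1.
case: ifP => // m1; have -> : meet u v = 1%N by apply/eqP; rewrite eqn_leq m1 m0.
rewrite (meet_in (yuv yu)) dy /pair_const coef1 // divr1 !mulr1 mul1r expr2 mulrA.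
exact: lexx.
Qed.

(** Once [u] is visited, [hitting u] is frozen at [(dep u)%:R * coef delta (dep u)], while its
    expectation never exceeds 1. *)
Lemma hitting_bound n u : u != root ->
  \sum_(s <- paths n.+1 | u \in s) q s <= ((dep u)%:R * coef delta (dep u))^-1.
Proof.
move=> u0; have d0 : (0 < dep u)%N by rewrite lt0n depth_eq0.
have c0 : 0 < (dep u)%:R * coef delta (dep u).
  by rewrite mulr_gt0 ?coef_gt0 // ltr0n.
rewrite -[leRHS]mul1r ler_pdivlMr //.
have step : expect n.+1 (hitting' u) <= 1.
  elim: n => [|n IH].
    rewrite expect1_hitting //; case: (size _) => [|k]; first by rewrite invr0.
    by rewrite invf_le1 ?ler1n ?ltr0n.
  rewrite (le_trans _ IH) //; apply: expect_harmonic_le.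
    by move=> s; exact: hitting_ge0.
  move=> s sn; have [x [t sE]] := paths_cons sn; rewrite sE in sn *.
  by apply: hitting_harmonic => //; [exact: paths_closed sn|exact: (paths_head sn)].
rewrite (le_trans _ step) // mulr_suml /expect big_mkcond !big_seq.
apply: ler_sum => s sn; case: ifP => us; last by rewrite mulr_ge0 // hitting_ge0.
by rewrite ler_wpM2l // /hitting seenE ?us ?line_mem //; exact: paths_closed sn.
Qed.

(** The depth condition rules out a visit to [u] so far, so [hitting u] vanishes on a return to the
    root and killing loses nothing. *)
Lemma expect_hitting k u : (k.+1 < dep u)%N ->
  expect k.+1 (hitting' u) = (size (nbs root))%:R^-1.
Proof.
elim: k => [|k IH] ku.
  by rewrite expect1_hitting // -depth_eq0 -lt0n (ltn_trans _ ku).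
rewrite expect_harmonic_eq ?IH ?(ltnW ku) // => s sk.
  have sc := paths_closed sk.
  have u0 : u != root by rewrite -depth_eq0 -lt0n (leq_ltn_trans _ ku).
  rewrite /hitting (seen_in _ sc.1) seenE ?line_mem //=.
  case: ifP => [/(paths_depth sk)|_]; last by rewrite meet_root mul0r.
  by rewrite leqNgt (ltnW ku).
have [x [t sE]] := paths_cons sk; rewrite sE in sk *.
by apply: hitting_harmonic => //; [exact: paths_closed sk|exact: (paths_head sk)].
Qed.

Lemma expect_pair k u v : (k.+1 < dep u)%N -> (k.+1 < dep v)%N ->
  expect k.+1 (pair_hitting' u v) <= (size (nbs root))%:R^-1 * pair_const' (meet u v).
Proof.
elim: k => [|k IH] ku kv.
  by apply: expect1_pair; rewrite // -depth_eq0 -lt0n ltnW.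
rewrite (le_trans _ (IH (ltnW ku) (ltnW kv))) //; apply: expect_harmonic_le.
  by move=> s; exact: pair_hitting_ge0.
move=> s sk; have [x [t sE]] := paths_cons sk; rewrite sE in sk *.
have dx : (dep x <= k.+1)%N by apply: (paths_depth sk); exact: mem_head.
apply: pair_hitting_harmonic => //; first exact: paths_closed sk.
- exact: (paths_head sk).
- by rewrite (leq_ltn_trans dx) // ltnW.
- by rewrite (leq_ltn_trans dx) // ltnW.
Qed.

(* Second moment method for [M], the sum of [hitting u] weighted by the flow. *)
Lemma survival_ge (lambda eps : R) : delta < lambda -> 0 < eps ->
  (forall pi, cutsets adj root pi -> (eps%:E <= cutset_sum adj root lambda pi)%E) ->
  exists2 c : R, 0 < c & forall n, c <= \sum_(s <- paths n.+1) q s.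
Proof.
move=> dl eps0 cut; have [K K0 KP] := pair_const_le delta_gt0.
pose E := 1 + delta * ((1 + lambda) ^+ 2 / (lambda - delta)).
have l0 := lt_trans delta_gt0 dl.
have E0 : 0 < E.
  by rewrite addr_gt0 // mulr_gt0 // divr_gt0 ?subr_gt0 // exprn_gt0 // addr_gt0.
pose e := Num.min eps 1; have e0 : 0 < e by rewrite lt_min eps0 ltr01.
pose d : R := (size (nbs root))%:R.
have d0 : 0 < d.
  have [theta [thetaP thetaS _]] := @flow_exists R lambda eps 1 eps0 cut.
  case: theta thetaP thetaS => [|p theta] thetaP; first by rewrite big_nil leNgt e0.
  have [dp _] := thetaP p (mem_head _ _).
  have [|z [_ z0 pz]] := @line_child p.1 root (mem_head _ _).
    by rewrite dp depth_root.
  rewrite ltr0n; have : z \in nbs root by rewrite (perm_mem nbs_root) mem_children z0 pz eqxx.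
  by case: (nbs root).
have KE0 : 0 < K * E by rewrite mulr_gt0.
exists (e / d / (4 * (K * E))); first by rewrite !divr_gt0 // mulr_gt0.
move=> n; set a := \sum_(s <- _) _.
(* Level [n + 2] is out of reach by time [n + 1], as [expect_hitting] and [expect_pair] require. *)
have [theta [thetaP thetaS thetaC]] := @flow_exists R lambda eps n.+2 eps0 cut.
set S := \sum_(p <- theta) p.2 in thetaS.
pose M s := \sum_(p <- theta) p.2 * hitting' p.1 s.
pose Q s := \sum_(p <- theta) p.2 * \sum_(r <- theta) r.2 * pair_hitting' p.1 r.1 s.
have EM : expect n.+1 M = S / d.
  rewrite expect_sum /S mulr_suml; apply: eq_big_seq => p /thetaP[dp _].
  by rewrite expect_hitting // dp.
have EQ : expect n.+1 Q <= K * E * (S / d).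
  rewrite expect_sum (le_trans (_ : _ <= \sum_(p <- theta) \sum_(r <- theta)
      (p.2 * r.2 * ((meet p.1 r.1)%:R * coef delta (meet p.1 r.1))) * (K / d))) //.
    rewrite !big_seq; apply: ler_sum => p /thetaP[dp p0].
    rewrite expect_sum mulr_sumr !big_seq; apply: ler_sum => r /thetaP[dr r0].
    rewrite mulrA -[leRHS]mulrA ler_wpM2l ?mulr_ge0 //.
    rewrite (le_trans (expect_pair _ _)) ?dp ?dr // mulrC mulrA ler_wpM2r //.
    by rewrite mulrC KP.
  under eq_bigr do rewrite -mulr_suml.
  rewrite -mulr_suml; have := pair_energy delta_gt0 dl thetaP thetaC.
  rewrite -(ler_pM2r (_ : 0 < K / d)) ?divr_gt0 // => /le_trans; apply.
  by rewrite -/E -/S le_eqVlt; apply/orP; left; apply/eqP; ring.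
have MQ s : s \in paths n.+1 -> M s ^+ 2 <= 4 * Q s.
  move=> sn; rewrite expr2 /M mulr_suml /Q mulr_sumr !big_seq.
  apply: ler_sum => p /thetaP[dp p0]; rewrite mulr_sumr mulr_sumr mulr_sumr !big_seq.
  apply: ler_sum => r /thetaP[dr r0].
  have [x [t sE]] := paths_cons sn; rewrite sE in sn *.
  have sc := paths_closed sn.
  have lt u : dep u = n.+2 -> (seen u (x :: t) < dep u)%N.
    move=> du; have u0 : u != root by rewrite -depth_eq0 du.
    rewrite ltnNge seenE ?line_mem //; apply/negP => /(paths_depth sn).
    by rewrite du ltnn.
  have := ler_wpM2l (mulr_ge0 p0 r0) (hitting_mul_le delta_gt0 sc (lt _ dp) (lt _ dr)).
  rewrite mulrACA => /le_trans; apply.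
  by rewrite le_eqVlt; apply/orP; left; apply/eqP; ring.
(* Cauchy-Schwarz in linear form: with [t = K * E], the square of [M s - 4 t] being non-negative and
   [M s ^+ 2 <= 4 * Q s] give [M s <= Q s / (2 t) + 2 t]. *)
have EM2 : expect n.+1 M <= (2 * (K * E))^-1 * expect n.+1 Q + 2 * (K * E) * a.
  rewrite /expect /a !mulr_sumr -big_split !big_seq; apply: ler_sum => s sn /=.
  rewrite [_ * (q s * _)]mulrCA [_ * q s]mulrC -mulrDr ler_wpM2l //.
  have := MQ s sn; move: (M s) (Q s) (K * E) KE0 => m x t t0 mx.
  have t2 : 0 < 2 * t by rewrite mulr_gt0.
  rewrite -(ler_pM2l t2) mulrDr mulVKf ?gt_eqF //.
  have := sqr_ge0 (m - 4 * t); nra.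
have : S / d <= 4 * (K * E) * a.
  have h : (2 * (K * E))^-1 * expect n.+1 Q <= 2^-1 * (S / d).
    have i0 : 0 <= (2 * (K * E))^-1 by rewrite invr_ge0 ltW // mulr_gt0.
    rewrite (le_trans (ler_wpM2l i0 EQ)) // le_eqVlt; apply/orP; left; apply/eqP.
    by field; rewrite !gt_eqF.
  move: EM2 h; rewrite EM; move: (S / d) (K * E) (_ * expect _ _) => x t y; nra.
move=> h; rewrite ler_pdivrMr ?mulr_gt0 // [a * _]mulrC (le_trans _ h) //.
by rewrite ler_pM2r ?invr_gt0.
Qed.

Lemma expect1_le n : \sum_(s <- paths n.+1) q s <= 1.
Proof.
have -> : \sum_(s <- paths n.+1) q s = expect n.+1 (fun=> 1).
  by apply: eq_bigr => s _; rewrite mulr1.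
elim: n => [|n IH].
  rewrite expect1 /= big_const_seq count_predT iter_addr_0 -(perm_size nbs_root).
  case: (size _) => [|k]; first by rewrite mulr0.
  by rewrite mulVf // pnatr_eq0.
rewrite (le_trans _ IH) //; apply: expect_harmonic_le => // s _.
by rewrite /harmonic_at big1 // => y _; rewrite subrr mulr0.
Qed.

(* [v] decreases on average by at least [B ^+ D] at each step inside the ball. *)
Lemma ball_decay D (eta : R) : 0 < eta ->
  exists n, \sum_(s <- paths n.+1 | all (fun x => (dep x <= D)%N) s) q s <= eta.
Proof.
move=> eta0; have [K KP] := ball_degree D.
(* A lower bound for the probability of stepping to the parent: that edge has weight [delta], and at
   most [K] edges have weight at most [1 + delta] each. *)
pose c : R := delta / ((1 + delta) * K.+1%:R).
have d1 : 0 < 1 + delta by rewrite addr_gt0.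
have c0 : 0 < c by rewrite divr_gt0 // mulr_gt0 // ltr0n.
(* Chosen so that [2 * B <= c]: the parent alone then contributes at least [2 * B ^+ dep x] to the
   mean of [B ^+ dep], a gain of at least [B ^+ D] inside the ball. *)
pose B : R := (1 + 2 / c)^-1.
have c2 : 0 < 2 / c by rewrite divr_gt0.
have B0 : 0 < B by rewrite invr_gt0 addr_gt0.
have B1 : B <= 1 by rewrite invf_le1 ?addr_gt0 // lerDl ltW.
have Bc : 2 * B <= c.
  rewrite ler_pdivrMr ?addr_gt0 // mulrDr mulr1 mulrCA mulfV ?gt_eqF // mulr1.
  by rewrite lerDr ltW.
pose v x : R := 1 - B ^+ dep x.
have v0 x : 0 <= v x by rewrite subr_ge0 exprn_ile1 // ltW.
have v1 x : v x <= 1 by rewrite lerBlDr lerDl exprn_ge0 // ltW.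
pose inball := all (fun x => (dep x <= D)%N).
pose F s : R := if inball s then v (head root s) else 0.
pose Z n := \sum_(s <- paths n.+1 | inball s) q s.
have drift n s : s \in paths n.+1 -> inball s ->
    \sum_(y <- nbs (head root s)) reinforced' s y / total s * v y
      <= v (head root s) - B ^+ D.
  move=> sn sD; have [x [t sE]] := paths_cons sn; rewrite sE in sn sD *; rewrite /head.
  have x0 : x != root := paths_head sn.
  have xD : (dep x <= D)%N by case/andP: sD.
  have px : par x \in nbs x by rewrite mem_nbs parent_adj.
  have W0 : 0 < total (x :: t) by exact: (total_gt0 (x := par x)).
  have pH : par x \in x :: t by apply: (proj2 (paths_closed sn)); rewrite ?mem_head.
  have sum1 : \sum_(y <- nbs x) reinforced' (x :: t) y / total (x :: t) = 1.
    by rewrite -mulr_suml mulfV // gt_eqF.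
  have pc : c <= reinforced' (x :: t) (par x) / total (x :: t).
    rewrite /c /reinforced pH ler_pM2l // lef_pV2 ?posrE ?mulr_gt0 ?ltr0n //.
    rewrite /total /= (le_trans (_ : _ <= \sum_(y <- nbs x) (1 + delta))) //.
      apply: ler_sum => y _; rewrite /reinforced; case: ifP => _.
        by rewrite lerDr.
      by rewrite lerDl ltW.
    rewrite big_const_seq count_predT iter_addr_0 -[leLHS]mulr_natr.
    by rewrite ler_pM2l // ler_nat (leq_trans (KP x xD)).
  have -> : \sum_(y <- nbs x) reinforced' (x :: t) y / total (x :: t) * v y =
      1 - \sum_(y <- nbs x) reinforced' (x :: t) y / total (x :: t) * B ^+ dep y.
    by rewrite -sum1 -sumrB; apply: eq_bigr => y _; rewrite mulrBr mulr1.
  rewrite /v -addrA lerD2l -opprD lerN2 (big_rem (par x)) //=.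
  rewrite (le_trans (_ : _ <= 2 * B ^+ dep x)) //.
    rewrite [leRHS]mulr_natl mulr2n lerD2l; apply: ler_wiXn2l => //; exact: ltW.
  rewrite (depth_parent x0) exprS mulrA (le_trans (_ : _ <= c * B ^+ dep (par x))) //.
    by rewrite ler_wpM2r // exprn_ge0 // ltW.
  rewrite ler_wpDr //; last by rewrite ler_wpM2r // exprn_ge0 // ltW.
  rewrite sumr_ge0 // => y _; rewrite mulr_ge0 ?exprn_ge0 ?(ltW B0) //.
  by rewrite divr_ge0 // ltW // reinforced_gt0.
have Zexp k : Z k = expect k.+1 (fun s => (inball s)%:R).
  rewrite /Z /expect big_mkcond; apply: eq_bigr => s _.
  by case: ifP; rewrite ?mulr1 ?mulr0.
have step n : B ^+ D * Z n <= expect n.+1 F - expect n.+2 F.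
  rewrite lerBrDr -lerBrDl (expectS n.+1) Zexp /expect mulr_sumr -sumrB !big_seq.
  apply: ler_sum => s sn; rewrite mulrCA -mulrBr ler_wpM2l //.
  case: (boolP (inball s)) => sD; last first.
    rewrite [F s]/F (negPf sD) mulr0 subr0 big1 // => y _.
    by rewrite /F /= (negPf sD) andbF mulr0.
  rewrite mulr1 [F s]/F sD.
  rewrite (le_trans _ (drift n s sn sD)) // big_mkcond; apply: ler_sum => y _.
  have p0 : 0 <= reinforced' s y / total s.
    by rewrite divr_ge0 // ltW ?reinforced_gt0 ?(total_gt0 (paths_parent sn)).
  case: ifP => _; last by rewrite mulr_ge0.
  by rewrite ler_wpM2l // /F; case: ifP.
have mono n : Z n.+1 <= Z n.
  rewrite !Zexp expectS /expect !big_seq; apply: ler_sum => s sn; rewrite ler_wpM2l //.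
  have W0 := total_gt0 (paths_parent sn).
  rewrite (le_trans (_ : _ <= \sum_(y <- nbs (head root s))
      reinforced' s y / total s * (inball s)%:R)) //; last first.
    by rewrite -!mulr_suml mulfV ?gt_eqF // mul1r.
  rewrite big_mkcond; apply: ler_sum => y _.
  have p0 : 0 <= reinforced' s y / total s by rewrite divr_ge0 // ltW ?reinforced_gt0.
  case: ifP => _; last by rewrite mulr_ge0.
  by rewrite ler_wpM2l // /= ler_nat; case: (inball s); rewrite ?andbF //; case: (_ && _).
(* [Z] is nonincreasing, so [n] times its last value is at most the accumulated drift, which
   telescopes. *)
have tele n : n%:R * (B ^+ D * Z n) <= expect 1 F - expect n.+1 F.
  elim: n => [|n IH]; first by rewrite mul0r subrr.
  have h : B ^+ D * Z n.+1 <= B ^+ D * Z n by rewrite ler_wpM2l // exprn_ge0 // ltW.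
  rewrite -natr1 mulrDl mul1r.
  have h2 : n%:R * (B ^+ D * Z n.+1) <= n%:R * (B ^+ D * Z n) by rewrite ler_wpM2l.
  by have := step n; lra.
have F0 s : 0 <= F s by rewrite /F; case: ifP.
have F1 : expect 1 F <= 1.
  rewrite (le_trans _ (expect1_le 0)) // /expect; apply: ler_sum => s _.
  by rewrite ler_piMr // /F; case: ifP.
have BD0 : 0 < B ^+ D by rewrite exprn_gt0.
pose N := (Num.bound (B ^+ D * eta)^-1).
have NP : (B ^+ D * eta)^-1 < N%:R.
  by have := archi_boundP (_ : 0 <= (B ^+ D * eta)^-1); apply; rewrite invr_ge0 mulr_ge0 // ltW.
exists N; rewrite -/(Z N).
have N0 : 0 < N%:R :> R by rewrite (lt_trans _ NP) // invr_gt0 mulr_gt0.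
have En : 0 <= expect N.+1 F by rewrite sumr_ge0 // => s _; rewrite mulr_ge0.
have h : N%:R * (B ^+ D * Z N) <= 1 by have := tele N; lra.
rewrite -(ler_pM2l (mulr_gt0 N0 BD0)) -mulrA (le_trans h) //.
rewrite -mulrA -ler_pdivrMr ?mulr_gt0 // mul1r; exact: ltW.
Qed.

(** A union bound over the deeper endpoints of the edges of [pi]; [coef_lower] converts
    [hitting_bound] into a power of the depth. *)
Lemma cutset_visit_bound (pi : set (V * V)) n : pi `<=` edges adj root ->
  ((\sum_(s <- paths n.+1 | has (fun v => `[< exists2 e, pi e & e.2 = v >]) s) q s)%:E
    <= ((1 + delta) `^ delta)%:E * cutset_sum adj root delta pi)%E.
Proof.
move=> pi_edges; set piv := fun v : V => `[< exists2 e, pi e & e.2 = v >].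
have pivP v : piv v -> v != root /\ pi (par v, v).
  move=> /asboolP[[x u] pie /= <-]; have [/= xu du] := pi_edges _ pie.
  have u0 : u != root by rewrite -depth_eq0 du.
  by split=> //; rewrite (@parent_eq u x) // adjC.
(* By time [n + 1] only depths up to [n + 1] are reached, so finitely many endpoints matter even
   when [pi] is infinite. *)
pose vs := [seq v <- undup (flatten [seq level i | i <- iota 0 n.+2]) | piv v].
have vsP v : v \in vs -> v != root /\ pi (par v, v).
  by rewrite mem_filter => /andP[/pivP].
have C0 : 0 <= (1 + delta) `^ delta by exact: powR_ge0.
have le1 : \sum_(s <- paths n.+1 | has piv s) q s <=
    \sum_(v <- vs) (1 + delta) `^ delta * (dep v)%:R `^ (- delta).
  rewrite (le_trans (_ : _ <= \sum_(s <- paths n.+1) \sum_(v <- vs)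
      if v \in s then q s else 0)) //.
    rewrite big_mkcond !big_seq; apply: ler_sum => s sn.
    case: ifP => [/hasP[v vs_ pv]|_]; last first.
      by rewrite sumr_ge0 // => v _; case: ifP.
    rewrite (big_rem v) /=; last first.
      rewrite mem_filter pv mem_undup; apply/flattenP.
      exists (level (dep v)); last exact: mem_level.
      by apply: map_f; rewrite mem_iota /= ltnS (paths_depth sn).
    by rewrite vs_ lerDl sumr_ge0 // => u _; case: ifP.
  rewrite exchange_big /= !big_seq; apply: ler_sum => v /vsP[v0 _].
  rewrite -big_mkcond /= (le_trans (hitting_bound n v0)) //.
  have : (0 < dep v)%N by rewrite lt0n depth_eq0.
  case: (dep v) => // k _; have k0 : 0 < k.+1%:R `^ delta by rewrite powR_gt0 // ltr0n.
  have c0 := coef_gt0S k delta_gt0.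
  rewrite powRN ler_pdivlMr // ler_pdivrMl // mulrC; exact: coef_lower.
have le1E := le1; rewrite -lee_fin in le1E; rewrite (le_trans le1E) //.
rewrite -mulr_sumr EFinM lee_wpmul2l ?lee_fin //.
apply: esum_ge; exists [set` [seq (par v, v) | v <- vs]].
  split; first exact: finite_seq.
  by move=> e /= /mapP[v /vsP[_ pv] ->].
rewrite -fsbig_seq; last first.
  by rewrite map_inj_uniq ?filter_uniq ?undup_uniq // => u v [].
by rewrite big_map sumEFin.
Qed.

End chain.

(** A vertex with arbitrarily deep descendants in [H] has a child with the same property: otherwise
    the finitely many children would bound the depth. Iterating from the root gives the ray, and
    closure under parents puts it in [H]. *)
Lemma koenig (H : set V) : H root ->
  (forall x, H x -> x != root -> H (par x)) ->
  (forall D, exists2 x, H x & (D < dep x)%N) ->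
  exists2 nu, is_ray adj root nu & forall i, H (nu i).
Proof.
move=> H0 cH unb.
have lineH y : H y -> forall z, z \in root :: line y -> H z.
  elim/line_ind: y => [|y y0 IH] Hy z.
    by rewrite line_root inE => /eqP ->.
  rewrite lineE // !inE => /or3P[/eqP ->//|/eqP ->//|zp].
  by apply: (IH (cH _ Hy y0)); rewrite inE zp orbT.
pose inf x := forall D, exists y, [/\ H y, x \in root :: line y & (D < dep y)%N].
have inf_child x : inf x -> exists z, z \in children x /\ inf z.
  move=> ix; apply: contrapT => /forallNP nz.
  have /choice[f fP] : forall z, exists D, z \in children x ->
      forall y, H y -> z \in line y -> (dep y <= D)%N.
    move=> z; have [zx|_] := boolP (z \in children x); last by exists 0%N.
    have /not_andP[//|/existsNP[D /forallNP nD]] := nz z.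
    exists D => _ y Hy zy; rewrite leqNgt; apply/negP => Dy; apply: (nD y).
    by split; rewrite // inE zy orbT.
  have [y [Hy xy]] := ix (maxn (dep x) (\max_(z <- children x) f z)).
  rewrite gtn_max => /andP[xly fy].
  have [z [zy z0 pz]] := line_child xy xly.
  have zx : z \in children x by rewrite mem_children z0 pz eqxx.
  have := fP z zx y Hy zy; rewrite leqNgt => /negP; apply.
  by rewrite (leq_ltn_trans _ fy) // (@leq_bigmax_seq _ _ xpredT f z zx).
have /choice[g gP] : forall x, exists z, inf x -> z \in children x /\ inf z.
  move=> x; have [ix|nix] := pselect (inf x); last by exists root.
  by have [z zP] := inf_child x ix; exists z.
pose nu i := iter i g root.
have inf0 : inf root.
  move=> D; have [y Hy Dy] := unb D; exists y.
  by split=> //; exact: mem_head.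
have infn i : inf (nu i) by elim: i => // i IH; exact: (gP _ IH).2.
have childn i : nu i.+1 \in children (nu i) by exact: (gP _ (infn i)).1.
have depn i : dep (nu i) = i.
  by elim: i => [|i IH]; rewrite ?depth_root // (depth_children (childn i)) IH.
exists nu.
  split=> // [i|i j ij]; last by rewrite -(depn i) -(depn j) ij.
  have := childn i; rewrite mem_children => /andP[z0 /eqP <-].
  by rewrite adjC parent_adj.
move=> i; have [y [Hy iy _]] := infn i 0%N; exact: lineH iy.
Qed.

(** * The law of the walk *)

Section walk.
Context (R : realType) (delta : R) (d : measure_display) (T : measurableType d).
Context (P : probability T R) (X : nat -> T -> V).
Hypothesis delta_gt0 : 0 < delta.
Hypothesis orrw_X : is_orrw P adj root delta X.

Fixpoint traj n w : seq V :=
  if n is n'.+1 then X n w :: traj n' w else [:: X 0 w].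

Lemma head_traj n w : head root (traj n w) = X n w.
Proof. by case: n. Qed.

Lemma mem_traj n w v : v \in traj n w -> exists2 k, (k <= n)%N & X k w = v.
Proof.
elim: n => [|n IH] /=; first by rewrite inE => /eqP ->; exists 0%N.
by rewrite inE => /predU1P[->|/IH[k kn kv]]; [exists n.+1|exists k; rewrite // ltnW].
Qed.

Lemma traj_mem n w k : (k <= n)%N -> X k w \in traj n w.
Proof.
elim: n => [|n IH]; first by rewrite leqn0 => /eqP ->; rewrite mem_head.
rewrite leq_eqVlt => /orP[/eqP ->|/IH kn]; first exact: mem_head.
by rewrite inE kn orbT.
Qed.

Lemma traj_paths n w : X 0 w = root ->
  (forall k, (k < n)%N -> adj (X k w) (X k.+1 w) /\ X k.+1 w != root) ->
  traj n w \in paths n.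
Proof.
move=> X0; elim: n => [|n IH] Xn; first by rewrite /= X0 mem_head.
apply: mem_pathsS; rewrite ?head_traj; try exact: (Xn n _).1; try exact: (Xn n _).2.
by apply: IH => k kn; apply: Xn; exact: ltnW.
Qed.

Lemma paths_traj n w : traj n w \in paths n -> X 0 w = root /\
  forall k, (k < n)%N -> adj (X k w) (X k.+1 w) /\ X k.+1 w != root.
Proof.
elim: n => [|n IH]; first by rewrite !inE => /eqP[].
move=> /pathsS[y [s [[<- <-] sn]]]; rewrite head_traj => ay y0.
have [X0 Xn] := IH sn; split=> // k; rewrite ltnS leq_eqVlt => /orP[/eqP ->//|].
exact: Xn.
Qed.

(** If the walk arrives at [X k w] from a child, then by induction that child was entered earlier
    from [X k w] itself; the argument repeats at this earlier visit. *)
Lemma first_crossing n w k : traj n w \in paths n -> (k <= n)%N -> X k w != root ->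
  exists j, [/\ (1 <= j <= k)%N, X j.-1 w = par (X k w) & X j w = X k w].
Proof.
move=> /paths_traj[X0 Xn]; elim/ltn_ind: k => k IH kn k0.
case: k IH kn k0 => [|k] IH kn k0; first by rewrite X0 eqxx in k0.
have [ak _] := Xn k kn.
have [[u0 pu]|[_ pk]] := adj_cases ak; last by exists k.+1; rewrite leqnn.
have [j [/andP[j1 jk] jp jX]] := IH k (ltnSn k) (ltnW kn) u0.
rewrite pu -jp in k0 *.
case: j j1 jk jp jX k0 => // j _ jk jp jX k0.
have [||i [/andP[i1 ij] ip iX]] := IH j _ _ k0.
- by rewrite ltnS ltnW.
- by rewrite (leq_trans (ltnW jk)) // ltnW.
exists i; split=> //; rewrite i1 (leq_trans ij) //.
by rewrite (leq_trans (ltnW jk)) // leqnSn.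
Qed.

Lemma weight_traj n w x y : traj n w \in paths n -> X n w = x -> adj x y ->
  weight adj root delta X n w x y = reinforced delta (traj n w) y.
Proof.
move=> tn Xx xy; rewrite /weight /reinforced; congr (if _ then _ else _).
apply/asboolP/idP => [[e [_ [k [/andP[k1 kn] ek]]] exy]|].
  have yk : y = X k.-1 w \/ y = X k w.
    case: ek exy => [->|->] [[-> ->]|[-> ->]]; [by right|by left|by left|by right].
  case: yk => ->; apply: traj_mem => //.
  by rewrite (leq_trans (leq_pred k)).
move=> /mem_traj[k kn kX].
case: (adj_cases xy) => [[x0 yE]|[y0 xE]].
  have [|j [/andP[j1 jn] jp jX]] := first_crossing tn (leqnn n); first by rewrite Xx.
  exists (y, x); last by right.
  split; first by rewrite /edges /= yE adjC parent_adj // -depth_parent.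
  by exists j; rewrite j1 jn; split=> //; left; rewrite jp jX Xx yE.
have [|j [/andP[j1 jn] jp jX]] := first_crossing tn kn; first by rewrite kX.
exists (x, y); last by left.
split; first by rewrite /edges /= xy xE -depth_parent.
exists j; rewrite j1 (leq_trans jn kn); split=> //; left.
by rewrite jp jX kX xE.
Qed.

Lemma step_prob_traj n w y : traj n w \in paths n -> adj (X n w) y ->
  step_prob adj root delta X n w (X n w) y =
  reinforced delta (traj n w) y / total delta (traj n w).
Proof.
move=> tn ay; rewrite /step_prob (weight_traj tn) //; congr (_ / _).
rewrite fsbig_finite; [|exact: locfin_adj].
rewrite /total head_traj; apply: eq_big_seq => z.
by rewrite -/(nbs _) mem_nbs => az; rewrite (weight_traj tn).
Qed.

Lemma history_sigma n : sigma_algebra setT (history X n).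
Proof. exact: smallest_sigma_algebra. Qed.

Lemma history_X n k v : (k <= n)%N -> history X n [set w | X k w = v].
Proof.
move=> kn; apply: sub_sigma_algebra; exists k => //=.
by exists [set v] => //; rewrite setTI.
Qed.

Lemma history_traj n s : history X n [set w | traj n w = s].
Proof.
have [|/(_ (history_sigma _))[_ _ _ hI] _] := @sigma_algebraP _ setT (history X n) _.
  by [].
suff h m : (m <= n)%N -> history X n [set w | traj m w = s].
  exact: h.
elim: m s => [|m IH] s mn.
  case: s => [|v [|u s]].
  - by rewrite (_ : [set w | _] = set0); [exact: sigma_algebra0|apply/seteqP; split].
  - rewrite (_ : [set w | _] = [set w | X 0 w = v]); first exact: history_X.
    by apply/seteqP; split=> w /=; [case|move=> ->].
  - by rewrite (_ : [set w | _] = set0); [exact: sigma_algebra0|apply/seteqP; split].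
case: s => [|v s].
  by rewrite (_ : [set w | _] = set0); [exact: sigma_algebra0|apply/seteqP; split].
rewrite (_ : [set w | _] = [set w | X m.+1 w = v] `&` [set w | traj m w = s]).
  by apply: hI; [exact: history_X|apply: IH; exact: ltnW].
by apply/seteqP; split=> w /= [] -> ->.
Qed.

Lemma measurable_X n (B : set V) : measurable [set w | B (X n w)].
Proof. exact: (orrw_measurable orrw_X n B). Qed.

Lemma measurable_traj n s : measurable [set w | traj n w = s].
Proof.
elim: n s => [|n IH] [|v s] /=.
- by rewrite (_ : [set w | _] = set0) //; apply/seteqP; split.
- rewrite (_ : [set w | _] = [set w | X 0 w = v /\ s = [::]]).
    have [->|s0] := pselect (s = [::]); last first.
      by rewrite (_ : [set w | _] = set0) //; apply/seteqP; split => w [].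
    rewrite (_ : [set w | _] = [set w | [set v] (X 0 w)]); first exact: measurable_X.
    by apply/seteqP; split=> w /= => [[]|].
  by apply/seteqP; split=> w /= => [[-> ->]|[-> ->]].
- by rewrite (_ : [set w | _] = set0) //; apply/seteqP; split.
- rewrite (_ : [set w | _] = [set w | [set v] (X n.+1 w)] `&` [set w | traj n w = s]).
    by apply: measurableI; [exact: measurable_X|exact: IH].
  by apply/seteqP; split=> w /= [] -> ->.
Qed.

Lemma measurable_traj_mem n (L : seq (seq V)) : measurable [set w | traj n w \in L].
Proof.
elim: L => [|s L IH].
  by rewrite (_ : [set w | _] = set0) //; apply/seteqP; split.
rewrite (_ : [set w | _] = [set w | traj n w = s] `|` [set w | traj n w \in L]).
  by apply: measurableU => //; exact: measurable_traj.
apply/seteqP; split=> w /=; rewrite inE; first by move=> /predU1P.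
by move=> h; apply/predU1P.
Qed.

Definition path_prob s : R := fine (P [set w | traj (size s).-1 w = s]).

Lemma path_probE n s : size s = n.+1 -> (path_prob s)%:E = P [set w | traj n w = s].
Proof.
move=> sn; rewrite /path_prob sn fineK // fin_num_measure //.
exact: measurable_traj.
Qed.

Lemma path_prob_ge0 s : 0 <= path_prob s.
Proof. by rewrite fine_ge0 // measure_ge0. Qed.

Lemma path_prob_root : path_prob [:: root] = 1.
Proof.
rewrite /path_prob /=; suff -> : P [set w | [:: X 0 w] = [:: root]] = 1%E by [].
have mA : measurable [set w | [:: X 0 w] = [:: root]] by exact: (measurable_traj 0).
rewrite -(setCK [set w | _]) probability_setC; last exact: measurableC.
rewrite measure_negligible ?sube0 //; first exact: measurableC.
by apply: negligibleS (orrw_start orrw_X) => w /= h h'; apply: h; rewrite h'.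
Qed.

(** The event that the trajectory is [s] belongs to the history, and on it the conditional
    probability is almost surely the constant of [step_prob_traj]; integrating over this event gives
    the product. *)
Lemma path_prob_step n s y : s \in paths n -> adj (head root s) y ->
  path_prob (y :: s) = path_prob s * (reinforced delta s y / total delta s).
Proof.
move=> sn ay; have sz := paths_size sn; apply: EFin_inj.
rewrite (@path_probE n.+1) /= ?sz // EFinM (path_probE sz).
have [Y [mY iY cY] aeY] := orrw_step orrw_X n y.
pose A := [set w | traj n w = s]; have mA : measurable A by exact: measurable_traj.
have := cY A (@history_traj n s).
have -> : A `&` [set w | X n.+1 w = y] = [set w | X n.+1 w :: traj n w = y :: s].
  by rewrite /A; apply/seteqP; split=> w /= [] -> ->.
move=> <-; set p := reinforced delta s y / total delta s.
rewrite (ae_eq_integral (cst p%:E)) //.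
- by rewrite integral_cst // muleC.
- apply: (@measurable_funS _ _ _ _ setT) => //.
  by move/integrableP : iY => [].
- move: aeY; apply: filterS => w h /= ws; congr EFin.
  rewrite h ?step_prob_traj ?ws //; first by rewrite -head_traj ws.
  by rewrite -head_traj ws.
Qed.

Lemma prob_traj_mem n (L : seq (seq V)) : uniq L -> {subset L <= paths n} ->
  P [set w | traj n w \in L] = (\sum_(s <- L) path_prob s)%:E.
Proof.
elim: L => [_ _|s L IH /= /andP[sL uL] Ln].
  rewrite big_nil (_ : [set w | _] = set0) ?measure0 //.
  by apply/seteqP; split.
have sz : size s = n.+1 by apply: paths_size; apply: Ln; rewrite mem_head.
rewrite big_cons EFinD (path_probE sz) -IH // => [|t tL]; last first.
  by apply: Ln; rewrite inE tL orbT.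
rewrite -measureU; [|exact: measurable_traj|exact: measurable_traj_mem|].
  congr (P _); apply/seteqP; split=> w /=; rewrite inE; first by move=> /predU1P.
  by move=> h; apply/predU1P.
by apply/seteqP; split=> w //= -[ws]; rewrite ws (negPf sL).
Qed.

(** * Return to the root, transience and recurrence *)

Definition returned : set T := [set w | exists2 n, (0 < n)%N & X n w = root].

Lemma return_timeE : [set w | (return_time R root X w < +oo)%E] = returned.
Proof.
apply/seteqP; split=> w /=.
  move=> h; apply: contrapT => nret; move: h; rewrite /return_time.
  rewrite (_ : [set n%:R%:E | n in _] = set0) ?ereal_inf0 ?ltxx //.
  by apply/seteqP; split=> x //= -[n [n0 Xn] _]; apply: nret; exists n.
move=> [n n0 Xn]; rewrite (le_lt_trans _ (ltry n%:R)) //.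
by apply: ereal_inf_lbound; exists n.
Qed.

Lemma measurable_returned_by N :
  measurable [set w | exists2 n, (0 < n <= N)%N & X n w = root].
Proof.
elim: N => [|N IH].
  rewrite (_ : [set w | _] = set0) //; apply/seteqP; split=> w //= -[n].
  by rewrite leqn0 lt0n; case: eqP.
rewrite (_ : [set w | _] = [set w | exists2 n, (0 < n <= N)%N & X n w = root]
    `|` [set w | [set root] (X N.+1 w)]).
  by apply: measurableU => //; exact: measurable_X.
apply/seteqP; split=> w /=.
  move=> [n /andP[n0]]; rewrite leq_eqVlt => /orP[/eqP -> h|nN h]; first by right.
  by left; exists n; rewrite ?n0.
move=> [[n /andP[n0 nN] h]|h]; first by exists n; rewrite ?n0 // ltnW.
by exists N.+1; rewrite ?leqnn.
Qed.

Lemma returned_bigcup : returned =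
  \bigcup_N [set w | exists2 n, (0 < n <= N)%N & X n w = root].
Proof.
apply/seteqP; split=> w /=.
  by move=> [n n0 Xn]; exists n => //; exists n; rewrite ?n0 ?leqnn.
by move=> [N _ [n /andP[n0 _] Xn]]; exists n.
Qed.

Lemma measurable_returned : measurable returned.
Proof.
rewrite returned_bigcup; apply: bigcupT_measurable => N.
exact: measurable_returned_by.
Qed.

Lemma transient_of_gap (lambda : R) : delta < lambda ->
  (0 < ereal_inf [set cutset_sum adj root lambda pi | pi in cutsets adj root])%E ->
  transient P root X.
Proof.
move=> dl inf0.
(* The infimum may be infinite, in which case [eps = 1] serves. *)
have [eps eps0 cut] : exists2 eps : R, 0 < eps & forall pi, cutsets adj root pi ->
    (eps%:E <= cutset_sum adj root lambda pi)%E.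
  move: inf0; set I := ereal_inf _ => I0.
  have IP pi : cutsets adj root pi -> (I <= cutset_sum adj root lambda pi)%E.
    by move=> cpi; apply: ereal_inf_lbound; exists pi.
  case: I I0 IP => [r r0 IP|_ IP|//].
    by exists r.
  by exists 1 => // pi /IP; rewrite leye_eq => /eqP ->; exact: leey.
have [c c0 cP] := survival_ge delta_gt0 path_prob_ge0 path_prob_root path_prob_step dl eps0 cut.
rewrite /transient /recurrent return_timeE => P1.
have bound N : (P [set w | exists2 n, (0 < n <= N.+1)%N & X n w = root] <= (1 - c)%:E)%E.
  have mS := measurable_traj_mem N.+1 (paths N.+1).
  have := probability_setC P mS.
  rewrite (prob_traj_mem (paths_uniq _)) // -EFinB => PS.
  apply: (@le_trans _ _ (P (~` [set w | traj N.+1 w \in paths N.+1]))); last first.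
    by rewrite PS lee_fin lerB.
  apply: le_measure; rewrite ?inE //.
  - exact: measurable_returned_by.
  - exact: measurableC.
  - move=> w [[//|n] /andP[_ nN] Xn] tw.
    by have [_ /(_ n nN)[_]] := paths_traj tw; rewrite Xn eqxx.
have : (P returned <= (1 - c)%:E)%E.
  have ndF : nondecreasing_seq (fun N => [set w | exists2 n, (0 < n <= N)%N & X n w = root]).
    apply/nondecreasing_seqP => N; apply/subsetPset => w [n /andP[n0 nN] Xn].
    by exists n; rewrite ?n0 // ltnW.
  have := nondecreasing_cvg_mu (mu := P) measurable_returned_by _ ndF.
  rewrite -returned_bigcup => /(_ measurable_returned) cvP.
  rewrite -(cvg_lim _ cvP) //; apply: lime_le; first by apply/cvg_ex; exists (P returned).
  apply: nearW => N /=; rewrite (le_trans _ (bound N)) //.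
  apply: le_measure; rewrite ?inE; [exact: measurable_returned_by|exact: measurable_returned_by|].
  by apply/subsetPset; exact: ndF.
rewrite P1 lee_fin; lra.
Qed.

(** The start at the root and the nearest-neighbour steps are built in, so that arguments on single
    trajectories apply; up to a null set this is the complement of [returned]. *)
Definition surviving : set T := \bigcap_n [set w | traj n.+1 w \in paths n.+1].

Lemma measurable_surviving : measurable surviving.
Proof. by apply: bigcapT_measurable => n; exact: measurable_traj_mem. Qed.

Lemma survivingP w : surviving w ->
  X 0 w = root /\ forall k, adj (X k w) (X k.+1 w) /\ X k.+1 w != root.
Proof.
move=> sw; split; first by have [] := paths_traj (sw 0%N I).
by move=> k; have [_ /(_ k (ltnSn k))] := paths_traj (sw k I).
Qed.

Lemma stay_negligible D :
  P.-negligible (surviving `&` [set w | forall n, (dep (X n w) <= D)%N]).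
Proof.
pose L n := [seq s <- paths n.+1 | all (fun x => (dep x <= D)%N) s].
pose S := \bigcap_n [set w | traj n.+1 w \in L n].
have mS : measurable S by apply: bigcapT_measurable => n; exact: measurable_traj_mem.
exists S; split => //; last first.
  move=> w [sw wD] n _; rewrite /= mem_filter (sw n I) andbT.
  by apply/allP => v vt; have [k _ <-] := @mem_traj n.+1 w v vt.
apply/eqP; rewrite eq_le measure_ge0 andbT; apply/lee_addgt0Pr => e e0; rewrite add0e.
have [n ne] := ball_decay delta_gt0 path_prob_ge0 path_prob_root path_prob_step D e0.
apply: (@le_trans _ _ (P [set w | traj n.+1 w \in L n])).
  apply: le_measure; rewrite ?inE //; first exact: measurable_traj_mem.
  by move=> w /(_ n I).
rewrite prob_traj_mem ?filter_uniq ?paths_uniq //; last exact: mem_subseq (filter_subseq _ _).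
by rewrite lee_fin big_filter.
Qed.

Lemma measurable_visit (B : set V) n :
  measurable [set w | has (fun v => `[< B v >]) (traj n w)].
Proof.
elim: n => [|n IH] /=.
  rewrite (_ : [set w | _] = [set w | B (X 0 w)]); first exact: measurable_X.
  by apply/seteqP; split=> w /=; rewrite orbF => /asboolP.
rewrite (_ : [set w | _] = [set w | B (X n.+1 w)] `|`
    [set w | has (fun v => `[< B v >]) (traj n w)]).
  by apply: measurableU => //; exact: measurable_X.
apply/seteqP; split=> w /=; first by move=> /orP[/asboolP|]; [left|right].
by move=> [/asboolP ->//|->]; rewrite orbT.
Qed.

(** Off a null set a surviving trajectory is unbounded, and the vertices it visits are closed under
    parents. By [koenig] they contain a ray, on which [pi] has an edge, so some finite time
    witnesses a visit to its deeper endpoint. *)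
Lemma surviving_le pi : cutsets adj root pi ->
  (P surviving <= ((1 + delta) `^ delta)%:E * cutset_sum adj root delta pi)%E.
Proof.
move=> [pi_edges pi_cut]; pose B : set V := [set v | exists2 e, pi e & e.2 = v].
pose G n := surviving `&` [set w | has (fun v => `[< B v >]) (traj n.+1 w)].
have mG n : measurable (G n).
  by apply: measurableI; [exact: measurable_surviving|exact: measurable_visit].
have mGG : measurable (\bigcup_n G n) by exact: bigcupT_measurable.
have ndG : nondecreasing_seq G.
  apply/nondecreasing_seqP => n; apply/subsetPset => w [sw Bw]; split=> //=.
  by move: Bw => /= ->; rewrite orbT.
have PG n : (P (G n) <= ((1 + delta) `^ delta)%:E * cutset_sum adj root delta pi)%E.
  have := cutset_visit_bound delta_gt0 path_prob_ge0 path_prob_root path_prob_step n pi_edges.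
  apply: le_trans; rewrite -big_filter -(@prob_traj_mem n.+1); last 2 first.
  - by rewrite filter_uniq // paths_uniq.
  - exact: mem_subseq (filter_subseq _ _).
  apply: le_measure; rewrite ?inE //; first exact: measurable_traj_mem.
  by move=> w [sw Bw]; rewrite /= mem_filter (sw n I) andbT.
have PGG : (P (\bigcup_n G n) <= ((1 + delta) `^ delta)%:E * cutset_sum adj root delta pi)%E.
  have cvP := nondecreasing_cvg_mu (mu := P) mG mGG ndG.
  rewrite -(cvg_lim _ cvP) //; apply: lime_le; first by apply/cvg_ex; eexists; exact: cvP.
  by apply: nearW => n; exact: PG.
have [N [mN N0 stayN]] := negligible_bigcup stay_negligible.
apply: (@le_trans _ _ (P (\bigcup_n G n `|` N))).
  apply: le_measure; rewrite ?inE //; first exact: measurable_surviving.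
    exact: measurableU.
  move=> w sw; have [X0 Xw] := survivingP sw.
  have [[D wD]|unb] := pselect (exists D, forall n, (dep (X n w) <= D)%N).
    by right; apply: stayN; exists D.
  left; have [||D|nu rnu nuP] := @koenig (fun v => exists k, X k w = v).
  - by exists 0%N.
  - move=> _ [k <-] k0.
    have [|j [_ jp _]] := @first_crossing k.+1 w k (sw k I) (leqnSn k) _ => //.
    by exists j.-1.
  - have /forallNP/(_ D)/existsNP[n /negP] := unb.
    by rewrite -ltnNge => nD; exists (X n w) => //; exists n.
  have [i [[i0 [e pie ej]] _]] := pi_cut nu rnu.
  case: i i0 ej => // i _ /= ej; have [/= ae de] := pi_edges e pie.
  (* [joins] admits both orientations of the edge; the depths along the ray exclude the reversed
     one. *)
  have e2 : e.2 = nu i.+1.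
    case: ej => ej; rewrite ej //= in de *.
    have [d1 _] := ray_depth i rnu; have [d2 _] := ray_depth i.+1 rnu.
    move: de; rewrite d1 d2 => /eqP.
    by rewrite -[X in X == _]addn0 -addn2 eqn_add2l.
  have [k kX] := nuP i.+1; exists k => //; split=> //=.
  apply/orP; right; apply/hasP; exists (X k w); first exact: traj_mem.
  by apply/asboolP; exists e; rewrite // e2.
have PU : (P (\bigcup_n G n `|` N) <= P (\bigcup_n G n) + P N)%E by exact: measureU2.
by rewrite (le_trans PU) // N0 adde0.
Qed.

Lemma recurrent_of_no_gap :
  (ereal_inf [set cutset_sum adj root delta pi | pi in cutsets adj root] <= 0)%E ->
  recurrent P root X.
Proof.
move=> inf0; rewrite /recurrent return_timeE.
have C0 : 0 < (1 + delta) `^ delta by rewrite powR_gt0 // addr_gt0.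
have Ps : P surviving = 0%E.
  apply/eqP; rewrite eq_le measure_ge0 andbT leNgt; apply/negP => P0.
  have Pfin : P surviving \is a fin_num
    by rewrite fin_num_measure //; exact: measurable_surviving.
  have p0 : 0 < fine (P surviving) / (1 + delta) `^ delta.
    by rewrite divr_gt0 // fine_gt0 // P0 ltey_eq Pfin.
  have p0E : (0 < (fine (P surviving) / (1 + delta) `^ delta)%:E)%E by rewrite lte_fin.
  have [_ [pi cpi <-] pis] := ereal_inf_lt (le_lt_trans inf0 p0E).
  have := surviving_le cpi; rewrite leNgt => /negP; apply.
  rewrite -[ltRHS](fineK Pfin) -[fine _](divfK (lt0r_neq0 C0)) mulrC EFinM.
  by rewrite lte_pmul2l // lte_fin.
have mR := measurable_returned.
have nR : P.-negligible (~` returned).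
  have [N [mN N0 NP]] : P.-negligible (~` [set w | X 0 w = root /\
      forall n, adj (X n w) (X n.+1 w)]).
    have := ae_foralln (orrw_nearest_neighbor orrw_X).
    move: (orrw_start orrw_X); apply: filterS2 => w; by split.
  exists (surviving `|` N); split.
  - by apply: measurableU => //; exact: measurable_surviving.
  - apply/eqP; rewrite eq_le measure_ge0 andbT.
    have PU : (P (surviving `|` N) <= P surviving + P N)%E.
      by apply: measureU2 => //; exact: measurable_surviving.
    by rewrite (le_trans PU) // Ps N0 adde0.
  - move=> w nret; have [good|bad] := pselect (X 0 w = root /\
        forall n, adj (X n w) (X n.+1 w)).
      left=> n _; apply: traj_paths => [|k _]; first exact: good.1.
      split; first exact: good.2.
      by apply/eqP => Xk; apply: nret; exists k.+1.
    by right; exact: NP.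
rewrite -(setCK returned) probability_setC; last exact: measurableC.
by rewrite measure_negligible ?sube0 //; exact: measurableC.
Qed.

End walk.

End tree.

Theorem theorem1 (R : realType) (V : choiceType) (adj : rel V) (root : V)
    (tree_adj : is_tree adj)
    (infinite_V : infinite_set [set: V])
    (locfin_adj : locally_finite adj)
    (delta : R) (delta_gt0 : 0 < delta)
    (d : measure_display) (T : measurableType d) (P : probability T R)
    (X : nat -> T -> V) (orrw_X : is_orrw P adj root delta X) :
  ((delta%:E < branching_ruin R adj root)%E -> transient P root X) /\
  ((branching_ruin R adj root < delta%:E)%E -> recurrent P root X).
Proof.
split=> [/ereal_sup_gt[_ [->|[lambda [_ inf0] <-]]]|br].
- by rewrite lte_fin ltNge (ltW delta_gt0).
- by rewrite lte_fin => dl; exact: (transient_of_gap tree_adj locfin_adj delta_gt0 orrw_X dl inf0).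
apply: (recurrent_of_no_gap tree_adj locfin_adj delta_gt0 orrw_X).
(* A positive infimum for the exponent [delta] itself would put [delta] into the set whose supremum
   is the branching-ruin number. *)
rewrite leNgt; apply/negP => inf0; move: br; rewrite ltNge => /negP; apply.
by apply: ereal_sup_ubound; right; exists delta.
Qed.
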